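(* The off-log metric $g^{\mathrm{OL}}$ on $\mathrm{Cor}^+(n)$ is isometric to the quotient metric $g^Q$ of the Riemannian submersion $$\pi:(\mathcal S^+(n),\star,g^{\mathrm{LE}})\longrightarrow(\mathcal S^+(n)/\mathrm{Diag}^+(n),g^Q),\qquad\pi(\Sigma)=\Sigma\star\mathrm{Diag}^+(n),$$ via the full-rank correlation matrices section $$\sigma_{\mathrm{corr}}:\mathcal S^+(n)/\mathrm{Diag}^+(n)\longrightarrow\mathrm{Cor}^+(n)\subset\mathcal S^+(n),\qquad[\Sigma]\longmapsto\Sigma\star D_\Sigma=\exp\bigl(\mathcal D(\log\Sigma)+\log\Sigma\bigr);$$ that is, $\sigma_{\mathrm{corr}}:(\mathcal S^+(n)/\mathrm{Diag}^+(n),g^Q)\to(\mathrm{Cor}^+(n),g^{\mathrm{OL}})$ is a Riemannian isometry.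
   Context: $\mathcal S(n)$ = real symmetric $n\times n$ matrices, $\mathcal S^+(n)$ = symmetric positive-definite ones, $\mathrm{Cor}^+(n)$ = matrices in $\mathcal S^+(n)$ with unit diagonal, $\mathrm{Hol}(n)$ = symmetric matrices with zero diagonal, $\mathrm{Diag}(n)$ = diagonal matrices, $\mathrm{Diag}^+(n)$ = diagonal matrices with positive diagonal entries. $\exp,\log$ are the matrix exponential and logarithm; $\mathrm{off}(A)$ is $A$ with its diagonal set to zero. The log-Euclidean group law on $\mathcal S^+(n)$ is $\Sigma_1\star\Sigma_2=\exp(\log\Sigma_1+\log\Sigma_2)$, and $\mathcal S^+(n)/\mathrm{Diag}^+(n)$ is the quotient by the subgroup $\mathrm{Diag}^+(n)$ for this law. $g^{\mathrm{LE}}=\log^*\langle\cdot,\cdot\rangle$ is the pullback of the Frobenius inner product $\langle A,B\rangle=\mathrm{tr}(AB)$ on $\mathcal S(n)$; $g^Q$ is the unique metric on the quotient making $\pi$ a Riemannian submersion. Known facts: for each $S\in\mathcal S(n)$ there is a unique $\mathcal D(S)\in\mathrm{Diag}(n)$ with $\exp(S+\mathcal D(S))\in\mathrm{Cor}^+(n)$, and $\mathcal D$ is smooth. Moreover $\mathrm{Log}:=\mathrm{off}\circ\log:\mathrm{Cor}^+(n)\to\mathrm{Hol}(n)$ is a diffeomorphism with inverse $S\mapsto\exp(S+\mathcal D(S))$. $D_\Sigma:=\exp(\mathcal D(\log\Sigma))$. The off-log metric is $g^{\mathrm{OL}}=\mathrm{Log}^*\langle\cdot,\cdot\rangle$. 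*)

(* Defs.v *)
From HB Require Import structures.
From mathcomp Require Import all_boot all_order all_algebra.
From mathcomp Require Import all_classical all_reals all_analysis.

Set Implicit Arguments.
Unset Strict Implicit.
Unset Printing Implicit Defensive.

Import Order.TTheory GRing.Theory Num.Theory.
Import numFieldNormedType.Exports.

Local Open Scope classical_set_scope.
Local Open Scope ring_scope.

Section SmoothOn.
Context {R : realType} {V W : normedModType R}.

(* For finite-dimensional [V] and open [U], [iter_diff k U f] for all [k] is
   the usual C^oo condition: each iterated directional derivative is
   differentiable on [U], hence continuous on [U]. *)
Fixpoint iter_diff (k : nat) (U : set V) (f : V -> W) : Prop :=
  if k is k'.+1 then
    (forall x, U x -> differentiable f x) /\
    (forall v, iter_diff k' U ('D_v f))
  else forall x, U x -> {for x, continuous f}.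

Definition smooth_on (U : set V) (f : V -> W) : Prop :=
  forall k, iter_diff k U f.

End SmoothOn.

(* A manifold is given by its points and its algebra C^oo(M), which determines
   its smooth maps, smooth curves and tangent vectors. *)
Record smooth_space (R : realType) := SmoothSpace {
  space_sort :> Type;
  smooth_fun : set (space_sort -> R)
}.

Section SmoothSpaces.
Context {R : realType}.
Implicit Types M N : smooth_space R.

(* Submanifold structure on a subset of a normed space: the smooth functions
   are those which extend, near each point, to a smooth function on an open
   subset of the ambient space. *)
Definition subset_smooth (V : normedModType R) (A : set V) : set (A -> R) :=
  [set phi | forall p : A, exists (U : set V) (F : V -> R),
    [/\ open U, U (val p), smooth_on U F
      & forall q : A, U (val q) -> F (val q) = phi q]].

Definition subset_space (V : normedModType R) (A : set V) : smooth_space R :=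
  SmoothSpace (@subset_smooth V A).

(* Quotient manifold structure along a surjection [f]: the only one for which
   [f] can be a surjective submersion, since then [phi] is smooth iff
   [phi \o f] is. *)
Definition quotient_space M (Q : Type) (f : M -> Q) : smooth_space R :=
  SmoothSpace [set phi : Q -> R | smooth_fun (phi \o f)].

Definition smooth_map M N (f : M -> N) : Prop :=
  forall phi : N -> R, smooth_fun phi -> smooth_fun (phi \o f).

Definition diffeomorphism M N (f : M -> N) : Prop :=
  smooth_map f /\
  exists h : N -> M, [/\ smooth_map h, cancel f h & cancel h f].

Definition smooth_curve M (c : R -> M) : Prop :=
  forall phi : M -> R, smooth_fun phi -> smooth_on [set: R] (phi \o c).

(* Tangent vectors act on C^oo(M); to have a unique representation they are
   given the value 0 on the functions which are not smooth. *)
Definition functional M : Type := (M -> R) -> R.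

Definition velocity M (c : R -> M) : functional M :=
  fun phi => if `[< smooth_fun phi >] then derive1 (phi \o c) 0 else 0.

Definition tangent M (p : M) : set (functional M) :=
  [set v | exists c : R -> M, [/\ smooth_curve c, c 0 = p & v = velocity c]].

(* [push f v] is d_p f (v) when [v] is tangent at [p]. *)
Definition push M N (f : M -> N) (v : functional M) : functional N :=
  fun phi => if `[< smooth_fun phi >] then v (phi \o f) else 0.

Definition smooth_field M (X : M -> functional M) : Prop :=
  (forall p, tangent p (X p)) /\
  (forall phi : M -> R, smooth_fun phi -> smooth_fun (fun p => X p phi)).

(* [g p u v] is meaningful only for [u] and [v] tangent at [p]. *)
Definition metric M : Type := M -> functional M -> functional M -> R.

Definition metric_eq M (g h : metric M) : Prop :=
  forall p u v, tangent p u -> tangent p v -> g p u v = h p u v.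

Definition riemannian_metric M (g : metric M) : Prop :=
  [/\ forall p (a : R) u v w, tangent p u -> tangent p v -> tangent p w ->
        g p (fun phi => a * u phi + v phi) w = a * g p u w + g p v w,
      forall p u v, tangent p u -> tangent p v -> g p u v = g p v u,
      forall p u, tangent p u -> u <> (fun=> 0) -> 0 < g p u u
    & forall X Y, smooth_field X -> smooth_field Y ->
        smooth_fun (fun p => g p (X p) (Y p))].

Definition pullback M N (f : M -> N) (h : metric N) : metric M :=
  fun p u v => h (f p) (push f u) (push f v).

Definition riemannian_isometry M N (gM : metric M) (gN : metric N)
    (f : M -> N) : Prop :=
  [/\ riemannian_metric gM, riemannian_metric gN, diffeomorphism f
    & metric_eq gM (pullback f gN)].

Definition submersion M N (f : M -> N) : Prop :=
  smooth_map f /\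
  forall p w, tangent (f p) w -> exists2 v, tangent p v & w = push f v.

Definition vertical M N (f : M -> N) (p : M) : set (functional M) :=
  [set v | tangent p v /\ push f v = (fun=> 0)].

Definition horizontal M N (gM : metric M) (f : M -> N) (p : M) :
    set (functional M) :=
  [set u | tangent p u /\ forall v, vertical f p v -> gM p u v = 0].

Definition riemannian_submersion M N (gM : metric M) (gN : metric N)
    (f : M -> N) : Prop :=
  [/\ riemannian_metric gM, riemannian_metric gN, submersion f
    & forall p u v, horizontal gM f p u -> horizontal gM f p v ->
        gN (f p) (push f u) (push f v) = gM p u v].

End SmoothSpaces.

Section Matrices.
Context {R : realType} {n : nat}.
Implicit Types (A B : 'M[R]_n).

Definition sym : set 'M[R]_n := [set A | A^T = A].

Definition spd : set 'M[R]_n :=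
  [set A | sym A /\ forall x : 'cV[R]_n, x != 0 -> 0 < (x^T *m A *m x) 0 0].

Definition cor : set 'M[R]_n := [set A | spd A /\ forall i, A i i = 1].

Definition hol : set 'M[R]_n := [set A | sym A /\ forall i, A i i = 0].

Definition diag : set 'M[R]_n := [set A | is_diag_mx A].

Definition diag_pos : set 'M[R]_n := [set A | diag A /\ forall i, 0 < A i i].

Definition off A : 'M[R]_n := \matrix_(i, j) (if i == j then 0 else A i j).

Definition expmx A : 'M[R]_n :=
  limn (series (fun k : nat => (k`!%:R : R)^-1 *: A ^+ k)).

(* The symmetric logarithm, i.e. the inverse of the bijection
   exp : S(n) -> S^+(n); it is 0 outside S^+(n). *)
Definition logmx A : 'M[R]_n := xget 0 [set X | sym X /\ expmx X = A].

(* The group law of S^+(n). *)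
Definition star A B : 'M[R]_n := expmx (logmx A + logmx B).

(* The map D of S(n) into Diag(n). *)
Definition cor_diag A : 'M[R]_n := xget 0 [set X | diag X /\ cor (expmx (A + X))].

(* D_Sigma *)
Definition cor_factor A : 'M[R]_n := expmx (cor_diag (logmx A)).

Definition star_coset A : set 'M[R]_n := [set star A B | B in diag_pos].

Definition mx (A : set 'M[R]_n) (p : subset_space A) : 'M[R]_n := val p.

(* The Frobenius metric on a submanifold [A] of matrices: [mx_coord u] is the
   matrix identified with the tangent vector [u]. *)
Definition mx_coord (A : set 'M[R]_n) (u : functional (subset_space A)) :
    'M[R]_n :=
  \matrix_(i, j) u (fun p => mx p i j).

Definition frobenius (A : set 'M[R]_n) : metric (subset_space A) :=
  fun _ u v => \tr (mx_coord u *m mx_coord v).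

Lemma logmx_sym A : logmx A \in sym.
Proof.
apply/mem_set; rewrite /logmx.
by case: xgetP => [X _ []//|_]; rewrite /sym /= trmx0.
Qed.

Lemma off_logmx_hol A : off (logmx A) \in hol.
Proof.
apply/mem_set; split; last by move=> i; rewrite mxE eqxx.
apply/matrixP => i j; rewrite !mxE eq_sym; case: eqP => // _.
by have /matrixP/(_ i j) := set_mem (logmx_sym A); rewrite mxE.
Qed.

Lemma star_coset_image (S : subset_space spd) :
  star_coset (mx S) \in star_coset @` spd.
Proof. by apply/mem_set; exists (mx S) => //; exact: set_mem (valP S). Qed.

End Matrices.

Section Spaces.
Context (R : realType) (n : nat).

Definition Sym : smooth_space R := subset_space (@sym R n).
Definition Spd : smooth_space R := subset_space (@spd R n).
Definition Cor : smooth_space R := subset_space (@cor R n).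
Definition Hol : smooth_space R := subset_space (@hol R n).

Definition to_coset (S : Spd) : star_coset @` (@spd R n) :=
  exist _ (star_coset (mx S)) (star_coset_image S).

(* S^+(n) / Diag^+(n), whose points are the cosets. *)
Definition Quo : smooth_space R := quotient_space to_coset.

Definition quo_pi : Spd -> Quo := to_coset.

Definition Spd_log : Spd -> Sym :=
  fun S => exist _ (logmx (mx S)) (logmx_sym (mx S)).

Definition Cor_Log : Cor -> Hol :=
  fun C => exist _ (off (logmx (mx C))) (off_logmx_hol (mx C)).

Definition gLE : metric Spd := pullback Spd_log (@frobenius R n sym).

Definition gOL : metric Cor := pullback Cor_Log (@frobenius R n hol).

Definition cor_to_spd (C : Cor) : Spd :=
  exist _ (mx C) (mem_set (proj1 (set_mem (valP C)))).

End Spaces.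

(* Main.v *)
Require Import Defs.
From HB Require Import structures.
From mathcomp Require Import all_boot all_order all_algebra.
From mathcomp Require Import all_classical all_reals all_analysis.
From mathcomp Require Import spectral complex ring lra.
Import Order.TTheory GRing.Theory Num.Theory.
Import numFieldNormedType.Exports.
Local Open Scope classical_set_scope.
Local Open Scope ring_scope.

(* Reading everything through the logarithm, S^+(n) becomes the Euclidean space
   S(n) = Hol(n) + Diag(n), an orthogonal sum, the fibres of pi become the
   translates of Diag(n), and pi becomes off : S(n) -> Hol(n), whose restriction
   to the horizontal space Hol(n) is the identity.  So [Sigma] |-> off (log Sigma)
   identifies g^Q with the Frobenius metric of Hol(n); composing with the
   inverse of Log : Cor^+(n) -> Hol(n) gives sigma_corr.

   The analytic content is that exp, log and the map D are smooth.
   - exp: the derivative of exp at A in the direction H is the upper right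
     block of exp [[A, H], [0, A]], so directional derivatives of exp are again
     exponentials (of larger matrices) of affine maps.
   - log and D: for X and Y symmetric with spectrum above -r,
     tr ((e^X - e^Y) (X - Y)) >= e^-r tr ((X - Y)^2), by expanding both traces
     in eigenbases of X and Y.  Hence the maps to be inverted are expanding on
     bounded sets, and a locally bounded inverse of a smooth expanding map is
     smooth.
   - D (S) exists because tr e^(S + D) - tr D is coercive in the diagonal
     matrix D, and its critical points have (e^(S + D))_ii = 1. *)

Set Implicit Arguments.
Unset Strict Implicit.
Unset Printing Implicit Defensive.

(** * Smooth maps between normed modules *)

(** In general S(n), S^+(n), Cor^+(n) and Hol(n) are not open in the space of all matrices, whereas
    smoothness is formulated on open sets. Each map to be inverted is therefore extended to all
    matrices through the symmetric part [symp], in such a way that it stays expanding. The inverse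
    is already known as a function, so only its smoothness is at stake; the expanding inequality
    supplies both its Lipschitz bound and the invertibility of the differential. The metric g^Q is
    defined as the pullback of g^OL by sigma_corr. The metric equation of the isometry then holds by
    definition, and the content moves to two facts: pi is a Riemannian submersion for this metric,
    and any metric with that property agrees with it on tangent vectors. Both rest on an explicit
    horizontal lift of curves, obtained by freezing the diagonal of the logarithm. *)

Section Differentiability.
Context {R : realType} {V W : normedModType R}.
Implicit Types (f g : V -> W) (x : V).

Lemma differentiable_near f x : differentiable f x ->
  forall e : R, 0 < e ->
    \forall y \near x, `|f y - f x - 'd f x (y - x)| <= e * `|y - x|.
Proof.
move=> df e e0.
have /eqaddoP/(_ _ e0) := diff_locally df.
rewrite (near_shift 0 x) /=; apply: filterS => y /=.
by rewrite /shift /= !fctE subr0 addrK opprD addrA.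
Qed.

Lemma near_differentiable f x (L : {linear V -> W}) : continuous L ->
  (forall e : R, 0 < e ->
    \forall y \near x, `|f y - f x - L (y - x)| <= e * `|y - x|) ->
  differentiable f x /\ 'd f x = L :> (V -> W).
Proof.
move=> cL fL.
have E : f \o shift x = cst (f x) + L +o_ 0 id.
  apply/eqaddoP => e e0.
  have := fL e e0; rewrite (near_shift 0 x) /=; apply: filterS => y /=.
  by rewrite /shift /= !fctE subr0 addrK opprD addrA.
have dE := diff_unique cL E; split => //.
by apply/diff_locallyP; rewrite dE.
Qed.

Lemma near_eq_differentiable f g x : {near x, f =1 g} ->
  differentiable f x -> differentiable g x.
Proof.
move=> fg df; have fgx := nbhs_singleton fg.
apply: (proj1 (near_differentiable (diff_continuous df) _)) => e e0.
by near=> y; rewrite -fgx -(near fg y)//; near: y; exact: differentiable_near.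
Unshelve. all: by end_near. Qed.

Lemma open_eq_near f g (U : set V) x : open U -> U x ->
  (forall y, U y -> f y = g y) -> {near x, f =1 g}.
Proof. by move=> oU Ux fg; apply: filterS (open_nbhs_nbhs (conj oU Ux)). Qed.

Implicit Types U : set V.

Lemma iter_diff_eq k U f g : open U -> (forall x, U x -> f x = g x) ->
  iter_diff k U f -> iter_diff k U g.
Proof.
move=> oU; elim: k f g => [|k IH] f g fg /=.
  move=> fc x Ux; have : f @ x --> g x by rewrite -fg//; exact: fc.
  by apply: cvg_trans; apply: near_eq_cvg; exact: open_eq_near fg.
move=> [df Df]; split=> [x Ux|v].
  by apply: near_eq_differentiable (df x Ux); exact: open_eq_near fg.
apply: IH (Df v) => x Ux; apply: near_eq_derive.
exact: open_eq_near fg.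
Qed.

Lemma iter_diff_sub k U (U' : set V) f : U' `<=` U ->
  iter_diff k U f -> iter_diff k U' f.
Proof.
move=> UU; elim: k f => [|k IH] f /=; first by move=> fc x /UU/fc.
by move=> [df Df]; split=> [x /UU/df//|v]; exact/IH/Df.
Qed.

Lemma iter_diff_local k U f :
  (forall x, U x -> exists2 U' : set V, U' x & iter_diff k U' f) ->
  iter_diff k U f.
Proof.
elim: k f => [|k IH] f /= H.
  by move=> x /H[U' /[swap]]; exact.
split=> [x /H[U' U'x [df _]]|v]; first exact: df.
by apply: IH => x /H[U' U'x [_ Df]]; exists U'.
Qed.

Lemma iter_diffW k U f : iter_diff k.+1 U f -> iter_diff k U f.
Proof.
elim: k f => [|k IH] f [df Df].
  by move=> x Ux; exact/differentiable_continuous/df.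
by split=> // v; exact/IH/Df.
Qed.

Lemma smooth_on_differentiable U f x : smooth_on U f -> U x -> differentiable f x.
Proof. by move=> /(_ 1%N)[+ _]; exact. Qed.

Lemma smooth_on_continuous U f x : smooth_on U f -> U x -> {for x, continuous f}.
Proof. by move=> /(_ 0%N); exact. Qed.

Lemma smooth_on_derive U f v : smooth_on U f -> smooth_on U ('D_v f).
Proof. by move=> sf k; have [_] := sf k.+1; exact. Qed.

Lemma iter_diff_cst k U (a : W) : iter_diff k U (cst a).
Proof.
elim: k a => [|k IH] a /=; first by move=> x _; exact: cvg_cst.
split=> [x _|v]; first exact: differentiable_cst.
rewrite (_ : 'D_v _ = cst 0)//; apply/funext => x /=; exact: derive_cst.
Qed.

Lemma iter_diff_linear k U (L : {linear V -> W}) : continuous L ->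
  iter_diff k U L.
Proof.
move=> cL; have dL x : differentiable L x by exact: linear_differentiable.
case: k => [|k] /=; first by move=> x _; exact: cL.
split=> // v; rewrite (_ : 'D_v _ = cst (L v)); first exact: iter_diff_cst.
by apply/funext => x; rewrite deriveE// diff_lin.
Qed.

Lemma iter_diffD k U f g : open U ->
  iter_diff k U f -> iter_diff k U g -> iter_diff k U (f \+ g).
Proof.
move=> oU; elim: k f g => [|k IH] f g /=.
  by move=> fc gc x Ux; apply: cvgD; [exact: fc|exact: gc].
move=> [df Df] [dg Dg]; split=> [x Ux|v].
  by apply: differentiableD; [exact: df|exact: dg].
apply: iter_diff_eq (IH _ _ (Df v) (Dg v)) => // x Ux /=.
by rewrite -deriveD//; apply/diff_derivable; [exact: df|exact: dg].
Qed.

Lemma iter_diff_sum k U (I : Type) (r : seq I) (P : pred I) (F : I -> V -> W) :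
  open U -> (forall i, P i -> iter_diff k U (F i)) ->
  iter_diff k U (fun x => \sum_(i <- r | P i) F i x).
Proof.
move=> oU FP; elim: r => [|i r IH].
  rewrite (_ : (fun _ => _) = cst 0); first exact: iter_diff_cst.
  by apply/funext => x; rewrite big_nil.
have [Pi|nPi] := boolP (P i); last first.
  apply: iter_diff_eq IH => // x Ux; by rewrite big_cons (negbTE nPi).
apply: iter_diff_eq (iter_diffD oU (FP i Pi) IH) => // x Ux.
by rewrite big_cons Pi.
Qed.

End Differentiability.

Section RealValued.
Context {R : realType} {V : normedModType R}.
Implicit Types (f g : V -> R) (U : set V).

Lemma iter_diffM k U f g : open U ->
  iter_diff k U f -> iter_diff k U g -> iter_diff k U (f \* g).
Proof.
move=> oU; elim: k f g => [|k IH] f g.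
  by move=> fc gc x Ux; apply: cvgM; [exact: fc|exact: gc].
move=> If Ig; have [If' Ig'] := (iter_diffW If, iter_diffW Ig).
move: If Ig => [df Df] [dg Dg]; split=> [x Ux|v].
  by apply: differentiableM; [exact: df|exact: dg].
have H := iter_diffD oU (IH _ _ If' (Dg v)) (IH _ _ Ig' (Df v)).
apply: iter_diff_eq H => // x Ux /=.
by rewrite [RHS]deriveM//; apply/diff_derivable; [exact: df|exact: dg].
Qed.

Lemma iter_diff_prod k U (I : Type) (r : seq I) (P : pred I) (F : I -> V -> R) :
  open U -> (forall i, P i -> iter_diff k U (F i)) ->
  iter_diff k U (fun x => \prod_(i <- r | P i) F i x).
Proof.
move=> oU FP; elim: r => [|i r IH].
  rewrite (_ : (fun _ => _) = cst 1); first exact: iter_diff_cst.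
  by apply/funext => x; rewrite big_nil.
have [Pi|nPi] := boolP (P i); last first.
  apply: iter_diff_eq IH => // x Ux; by rewrite big_cons (negbTE nPi).
apply: iter_diff_eq (iter_diffM oU (FP i Pi) IH) => // x Ux.
by rewrite big_cons Pi.
Qed.

Lemma iter_diffV k U f : open U -> (forall x, U x -> f x != 0) ->
  iter_diff k U f -> iter_diff k U (fun x => (f x)^-1).
Proof.
move=> oU f0; elim: k => [|k IH].
  by move=> fc x Ux; apply: cvgV; [exact: f0|exact: fc].
move=> If; have If' := iter_diffW If.
move: If => [df Df]; split=> [x Ux|v].
  by apply: differentiableV; [exact: df|exact: f0].
have H := iter_diffM oU (iter_diffM oU (IH If') (IH If')) (Df v).
have H' := iter_diffM oU (iter_diff_cst k U (-1 : R)) H.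
apply: iter_diff_eq H' => // x Ux /=.
rewrite deriveV; [|exact: f0|exact/diff_derivable/df].
by rewrite /cst /= mulN1r -invfM -expr2 scaleNr.
Qed.

End RealValued.

Section LinearComp.
Context {R : realType} {V W W' : normedModType R}.

Lemma iter_diff_linear_comp k (U : set V) (L : {linear W -> W'}) (f : V -> W) :
  open U -> continuous L -> iter_diff k U f -> iter_diff k U (L \o f).
Proof.
move=> oU cL; elim: k f => [|k IH] f /=.
  by move=> fc x Ux; apply: continuous_comp; [exact: fc|exact: cL].
have dL y : differentiable L y by exact: linear_differentiable.
move=> [df Df]; split=> [x Ux|v].
  by apply: differentiable_comp => //; exact: df.
apply: iter_diff_eq (IH _ (Df v)) => // x Ux /=.
have dLf : differentiable (L \o f) x.
  by apply: differentiable_comp => //; exact: df.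
rewrite (deriveE _ (df x Ux)) (deriveE _ dLf) (diff_comp (df x Ux) (dL _)).
by rewrite /= diff_lin.
Qed.

End LinearComp.

Section SmoothOnClosure.
Context {R : realType}.

Lemma smooth_on_linear (V W : normedModType R) (U : set V) (L : {linear V -> W}) :
  continuous L -> smooth_on U L.
Proof. by move=> cL k; exact: iter_diff_linear. Qed.

Lemma smooth_on_linear_comp (V W W' : normedModType R) (U : set V)
    (L : {linear W -> W'}) (f : V -> W) :
  open U -> continuous L -> smooth_on U f -> smooth_on U (L \o f).
Proof. by move=> oU cL sf k; exact: iter_diff_linear_comp. Qed.

Lemma smooth_onD (V W : normedModType R) (U : set V) (f g : V -> W) :
  open U -> smooth_on U f -> smooth_on U g -> smooth_on U (f \+ g).
Proof. by move=> oU sf sg k; exact: iter_diffD. Qed.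

Lemma smooth_on_cst (V W : normedModType R) (U : set V) (a : W) :
  smooth_on U (fun=> a).
Proof. by move=> k; exact: iter_diff_cst. Qed.

Lemma smooth_on_eq (V W : normedModType R) (U : set V) (f g : V -> W) :
  open U -> (forall x, U x -> f x = g x) -> smooth_on U f -> smooth_on U g.
Proof. by move=> oU fg sf k; exact: iter_diff_eq fg _. Qed.

End SmoothOnClosure.

Section MatrixValued.
Context {R : realType}.

Lemma mx_linear_continuous m n (W : normedModType R)
  (L : {linear 'M[R]_(m, n) -> W}) : continuous L.
Proof.
have -> : (L : _ -> _) = fun A => \sum_i \sum_j A i j *: L (delta_mx i j).
  apply/funext => A; rewrite {1}(matrix_sum_delta A) linear_sum.
  apply: eq_bigr => i _; rewrite linear_sum; apply: eq_bigr => j _.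
  by rewrite linearZ.
move=> A; apply: (@iter_diff_sum R _ W 0 setT) => //; first exact: openT.
move=> i _; apply: iter_diff_sum => //; first exact: openT.
move=> j _ B _.
have : (fun M : 'M[R]_(m, n) => M i j) @ B --> B i j by exact: coord_continuous.
by move/cvgZr_tmp; exact.
Qed.

Definition coord_mx m n (i : 'I_m) (j : 'I_n) (A : 'M[R]_(m, n)) : R := A i j.

Fact coord_mx_is_linear m n i j : linear (@coord_mx m n i j).
Proof. by move=> a A B; rewrite /coord_mx !mxE. Qed.

HB.instance Definition _ m n i j := GRing.isLinear.Build R 'M[R]_(m, n) R _
  (@coord_mx m n i j) (@coord_mx_is_linear m n i j).

Definition scale_mx m n (B : 'M[R]_(m, n)) (a : R) : 'M[R]_(m, n) := a *: B.

Fact scale_mx_is_linear m n B : linear (@scale_mx m n B : R^o -> _).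
Proof. by move=> a x y; rewrite /scale_mx scalerDl scalerA. Qed.

HB.instance Definition _ m n B := GRing.isLinear.Build R R^o 'M[R]_(m, n) _
  (@scale_mx m n B) (@scale_mx_is_linear m n B).

Lemma scale_mx_continuous m n (B : 'M[R]_(m, n)) : continuous (scale_mx B : R -> _).
Proof. by move=> a; exact: scalel_continuous. Qed.

Context {V : normedModType R}.

Lemma iter_diff_mxP m n k (U : set V) (F : V -> 'M[R]_(m, n)) : open U ->
  iter_diff k U F <-> forall i j, iter_diff k U (fun x => F x i j).
Proof.
move=> oU; split=> [IF i j|IF].
  apply: (iter_diff_linear_comp oU (L := coord_mx i j)) IF.
  exact: mx_linear_continuous.
have -> : F = fun x => \sum_i \sum_j scale_mx (delta_mx i j) (F x i j).
  by apply/funext => x; rewrite {1}(matrix_sum_delta (F x)).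
apply: iter_diff_sum => // i _; apply: iter_diff_sum => // j _.
apply: (iter_diff_linear_comp oU (L := scale_mx (delta_mx i j))) (IF i j).
exact: scale_mx_continuous.
Qed.

Lemma iter_diff_coord m n k (U : set 'M[R]_(m, n)) i j :
  iter_diff k U (fun A : 'M[R]_(m, n) => A i j).
Proof.
exact: (iter_diff_linear k U (@mx_linear_continuous _ _ _ (coord_mx i j))).
Qed.

Lemma derive_coord m n (F : V -> 'M[R]_(m, n)) x v i j : differentiable F x ->
  'D_v F x i j = 'D_v (fun y => F y i j) x.
Proof. by move=> dF; rewrite derive_mx ?mxE//; exact: diff_derivable. Qed.

(** [iter_diff] differentiates in constant directions, whereas the chain rule differentiates [g] in
    the moving direction ['D_v f x]. Expanding that direction on the matrix units leaves constant
    directions with scalar coefficients, the form on which the induction for compositions runs. *)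
Lemma derive_comp_mx m n (W : normedModType R) (f : V -> 'M[R]_(m, n))
    (g : 'M[R]_(m, n) -> W) x v :
  differentiable f x -> differentiable g (f x) ->
  'D_v (g \o f) x = \sum_i \sum_j 'D_v f x i j *: 'D_(delta_mx i j) g (f x).
Proof.
move=> df dg; rewrite deriveE; last exact: differentiable_comp.
rewrite diff_comp//= -(deriveE v df) {1}(matrix_sum_delta ('D_v f x)) linear_sum.
apply: eq_bigr => i _; rewrite linear_sum; apply: eq_bigr => j _.
by rewrite (deriveE _ dg) linearZ.
Qed.

End MatrixValued.

Section Composition.
Context {R : realType} {V : normedModType R}.

Let iter_diff_comp_real m n k (U : set V) (O : set 'M[R]_(m, n))
    (f : V -> 'M[R]_(m, n)) (g : 'M[R]_(m, n) -> R) :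
  open U -> (forall x, U x -> O (f x)) ->
  iter_diff k O g -> iter_diff k U f -> iter_diff k U (g \o f).
Proof.
move=> oU UO; elim: k f g UO => [|k IH] f g UO.
  move=> cg cf x Ux; apply: continuous_comp; first exact: cf.
  exact/cg/UO.
move=> Ig If; have [Ig' If'] := (iter_diffW Ig, iter_diffW If).
case: Ig If => [dg Dg] [df Df]; split=> [x Ux|v].
  by apply: differentiable_comp; [exact: df|exact/dg/UO].
have H : iter_diff k U (fun x => \sum_i \sum_j 'D_v f x i j *
    ('D_(delta_mx i j) g \o f) x).
  apply: iter_diff_sum => // i _; apply: iter_diff_sum => // j _.
  apply: iter_diffM => //; first by have /iter_diff_mxP := Df v; exact.
  by apply: IH If' => //; exact: Dg.
apply: iter_diff_eq H => // x Ux; rewrite derive_comp_mx//; first exact: df.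
exact/dg/UO.
Qed.

Lemma smooth_on_mxP m n (U : set V) (F : V -> 'M[R]_(m, n)) : open U ->
  smooth_on U F <-> forall i j, smooth_on U (fun x => F x i j).
Proof.
move=> oU; split=> [sF i j k|sF k]; first exact: (proj1 (iter_diff_mxP k F oU)).
by apply/iter_diff_mxP => // i j; exact: sF.
Qed.

Lemma smooth_on_comp_real m n (U : set V) (O : set 'M[R]_(m, n))
    (f : V -> 'M[R]_(m, n)) (g : 'M[R]_(m, n) -> R) :
  open U -> (forall x, U x -> O (f x)) ->
  smooth_on O g -> smooth_on U f -> smooth_on U (g \o f).
Proof. by move=> oU UO sg sf k; exact: iter_diff_comp_real (sg k) (sf k). Qed.

Lemma iter_diff_comp m n p q k (U : set V) (O : set 'M[R]_(m, n))
    (f : V -> 'M[R]_(m, n)) (g : 'M[R]_(m, n) -> 'M[R]_(p, q)) :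
  open U -> open O -> (forall x, U x -> O (f x)) ->
  iter_diff k O g -> iter_diff k U f -> iter_diff k U (g \o f).
Proof.
move=> oU oO UO Ig If; apply/iter_diff_mxP => // i j.
apply: (iter_diff_comp_real (g := fun A => g A i j) oU UO _ If).
by have /iter_diff_mxP := Ig; exact.
Qed.

Lemma smooth_on_comp m n p q (U : set V) (O : set 'M[R]_(m, n))
    (f : V -> 'M[R]_(m, n)) (g : 'M[R]_(m, n) -> 'M[R]_(p, q)) :
  open U -> open O -> (forall x, U x -> O (f x)) ->
  smooth_on O g -> smooth_on U f -> smooth_on U (g \o f).
Proof. by move=> oU oO UO sg sf k; exact: iter_diff_comp (sg k) (sf k). Qed.

Lemma iter_diff_det n k (U : set V) (F : V -> 'M[R]_n) : open U ->
  iter_diff k U F -> iter_diff k U (fun x => \det (F x)).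
Proof.
move=> oU /(iter_diff_mxP k F oU) IF.
apply: iter_diff_sum => // s _; apply: iter_diffM => //.
  exact: iter_diff_cst.
by apply: iter_diff_prod => // i _; exact: IF.
Qed.

(** Cramer's rule: the entries of the inverse are cofactors, polynomial in the entries of [F x],
    divided by a determinant that does not vanish on [U]. *)
Lemma iter_diff_invmx n k (U : set V) (F : V -> 'M[R]_n) : open U ->
  (forall x, U x -> F x \in unitmx) ->
  iter_diff k U F -> iter_diff k U (fun x => invmx (F x)).
Proof.
move=> oU uF IF.
have H : iter_diff k U (fun x => (\det (F x))^-1 *: \adj (F x)).
  apply/iter_diff_mxP => // i j.
  have H : iter_diff k U (fun x => (\det (F x))^-1 * (\adj (F x)) i j).
    apply: iter_diffM => //.
      apply: iter_diffV => //; last exact: iter_diff_det.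
      by move=> x /uF; rewrite unitmxE unitfE.
    have G : iter_diff k U (fun x => (-1) ^+ (j + i) *
        \det (\matrix_(p, q) F x (lift j p) (lift i q))).
      apply: iter_diffM => //; first exact: iter_diff_cst.
      apply: iter_diff_det => //; apply/iter_diff_mxP => // p q.
      have /(iter_diff_mxP k F oU)/(_ (lift j p) (lift i q)) := IF.
      by apply: iter_diff_eq => // x _; rewrite mxE.
    apply: iter_diff_eq G => // x _; rewrite mxE /cofactor; congr (_ * \det _).
    by apply/matrixP => p q; rewrite !mxE.
  by apply: iter_diff_eq H => // x _; rewrite [RHS]mxE.
apply: iter_diff_eq H => // x Ux; rewrite /invmx.
by have := uF x Ux; rewrite unitmxE => ->.
Qed.

End Composition.

(** * Smoothness of solutions [g] of [f \o g = h] for a smooth expanding [f] *)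

Section InverseFunction.
Context {R : realType} {V : normedModType R} {m n : nat}.
Implicit Types (f : 'M[R]_(m, n) -> 'M[R]_(m, n)) (X H : 'M[R]_(m, n)).

(** On each ball, [f] is injective with a Lipschitz inverse. The constant may be negative in
    degenerate cases, which is why [|C| + 1] replaces it below. *)
Definition locally_expanding f := forall r : R, exists C : R,
  forall X Y : 'M[R]_(m, n), `|X| <= r -> `|Y| <= r -> `|X - Y| <= C * `|f X - f Y|.

(** If the differential kills [H], then [f] moves X + t H by o(t) only, while the expanding bound
    forces a displacement of at least a fixed multiple of t |H|. *)
Lemma expanding_diff_inj f X H : locally_expanding f -> differentiable f X ->
  'd f X H = 0 -> H = 0.
Proof.
move=> /(_ (`|X| + 1))[C fC] df dH.
(* With [D] above [C], the slope [(D + D)^-1] allowed in the remainder yields |t H| <= |t H| / 2.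
   The choice of [t] keeps X + t H both in the differentiability ball of radius [d] and in the ball
   of radius |X| + 1 where [C] is valid. *)
pose D : R := `|C| + 1; have D0 : 0 < D by rewrite ltr_wpDl.
have e0 : 0 < (D + D)^-1 by rewrite invr_gt0 addr_gt0.
have /nbhs_ballP[d /= d0 hd] := differentiable_near df e0.
pose t := Num.min d 1 / (`|H| + 1).
have H1 : 0 < `|H| + 1 by rewrite ltr_wpDl.
have m0 : 0 < Num.min d 1 by rewrite lt_min d0 ltr01.
have t0 : 0 < t by rewrite divr_gt0.
have tH : `|t *: H| < Num.min d 1.
  rewrite normrZ gtr0_norm// /t mulrAC ltr_pdivrMr// ltr_pM2l//.
  by rewrite ltrDl.
have [tHd tH1] : `|t *: H| < d /\ `|t *: H| < 1.
  by move: tH; rewrite lt_min => /andP.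
have /hd : ball X d (X + t *: H).
  by rewrite -ball_normE /ball_/= opprD addNKr normrN.
rewrite [X + _ - X]addrAC subrr add0r linearZ/= dH scaler0 subr0 => fE.
have : `|X + t *: H - X| <= C * `|f (X + t *: H) - f X|.
  apply: fC; last by rewrite lerDl.
  by rewrite (le_trans (ler_normD _ _))// lerD2l ltW.
rewrite [X + _ - X]addrAC subrr add0r => h1.
have h2 : `|t *: H| <= 2^-1 * `|t *: H|.
  apply: le_trans h1 _; apply: (@le_trans _ _ (D * ((D + D)^-1 * `|t *: H|))).
    apply: (@le_trans _ _ (D * `|f (X + t *: H) - f X|)).
      by rewrite ler_wpM2r// (le_trans (ler_norm _))// lerDl.
    by rewrite ler_pM2l.
  have D1 : D != 0 by exact: lt0r_neq0.
  have D2 : D + D != 0 by apply/lt0r_neq0; exact: addr_gt0.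
  by rewrite (_ : D * _ = 2^-1 * `|t *: H|)//; field; rewrite ?D1 ?D2.
have : `|t *: H| <= 0 by lra.
by rewrite normr_le0 scaler_eq0 gt_eqF//= => /eqP.
Qed.

Lemma expanding_lin_mx_unit f X : locally_expanding f -> differentiable f X ->
  lin_mx ('d f X) \in unitmx.
Proof.
move=> fC df; rewrite -row_free_unit; apply: inj_row_free => v.
rewrite mul_rV_lin /= => /(congr1 vec_mx); rewrite mxvecK linear0.
by move=> /(expanding_diff_inj fC df)/(congr1 mxvec); rewrite vec_mxK linear0.
Qed.

Lemma mx_linear_bounded p q (W : normedModType R)
    (L : {linear 'M[R]_(p, q) -> W}) :
  exists2 k : R, 0 < k & forall x, `|L x| <= k * `|x|.
Proof. exact/linear_lipschitz/mx_linear_continuous. Qed.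

Variables (U : set V) (f : 'M[R]_(m, n) -> 'M[R]_(m, n)).
Variables (g h : V -> 'M[R]_(m, n)).
Hypotheses (oU : open U) (sf : smooth_on setT f) (sh : smooth_on U h).
Hypothesis fgh : forall x, U x -> f (g x) = h x.
Hypothesis g_bounded : forall x, U x -> exists r : R, \forall y \near x, `|g y| <= r.
Hypothesis f_exp : locally_expanding f.

Let g_lipschitz x : U x ->
  exists2 C : R, 0 < C & \forall y \near x, `|g y - g x| <= C * `|y - x|.
Proof.
move=> Ux; have [r gr] := g_bounded Ux; have [C fC] := f_exp r.
have dh := smooth_on_differentiable sh Ux.
have [k k0 kL] := linear_lipschitz (diff_continuous dh).
have C1 : 0 < `|C| + 1 by rewrite ltr_wpDl.
have k1 : 0 < k + 1 by rewrite ltr_wpDl// ltW.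
exists ((`|C| + 1) * (k + 1)); first exact: mulr_gt0.
have xr := nbhs_singleton gr.
have hU : \forall y \near x, U y by exact: open_nbhs_nbhs.
near=> y.
have Uy : U y by near: y.
have : `|g y - g x| <= C * `|f (g y) - f (g x)| by apply: fC => //; near: y.
rewrite !fgh// => /le_trans; apply; rewrite -mulrA.
apply: (@le_trans _ _ ((`|C| + 1) * `|h y - h x|)).
  by rewrite ler_wpM2r// (le_trans (ler_norm _))// lerDl.
rewrite ler_pM2l//.
have : `|h y - h x - 'd h x (y - x)| <= 1 * `|y - x|.
  by near: y; exact: differentiable_near.
rewrite mul1r => e1; rewrite -[h y - h x](subrK ('d h x (y - x))).
rewrite (le_trans (ler_normD _ _))// mulrDl mul1r addrC lerD//; exact: kL.
Unshelve. all: by end_near. Qed.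

Let inv_d x (u : 'M[R]_(m, n)) : 'M[R]_(m, n) :=
  vec_mx (mxvec u *m invmx (lin_mx ('d f (g x)))).

Let inv_d_linear x : linear (inv_d x).
Proof.
by move=> a u v; rewrite /inv_d !linearP/= mulmxDl -scalemxAl !linearP.
Qed.

(** The candidate differential is the inverse of ['d f (g x)] after ['d h x]. The remainder of [f]
    is small relative to g y - g x, and the Lipschitz bound on [g] makes it small relative to y -
    x. *)
Let g_differentiable x : U x -> differentiable g x.
Proof.
move=> Ux.
have df X : differentiable f X by exact: (smooth_on_differentiable sf).
have dh := smooth_on_differentiable sh Ux.
pose iL := GRing.isLinear.Build R 'M[R]_(m, n) 'M[R]_(m, n) _
  (inv_d x) (@inv_d_linear x).
pose I : {linear 'M[R]_(m, n) -> 'M[R]_(m, n)} := HB.pack (inv_d x) iL.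
have IK u : I ('d f (g x) u) = u.
  rewrite /= /inv_d -mul_vec_lin.
  by rewrite mulmxK ?mxvecK//; exact: expanding_lin_mx_unit.
have IB a b : I (a - b) = I a - I b by exact: linearB.
have [k k0 kI] := mx_linear_bounded I.
have [C C0 gC] := g_lipschitz Ux.
have cL : continuous (I \o 'd h x).
  move=> y; apply: continuous_comp; first exact: diff_continuous.
  exact: mx_linear_continuous.
have gx : g @ x --> g x.
  apply/cvgrPdist_le => e e0; near=> y.
  rewrite distrC; have /le_trans : `|g y - g x| <= C * `|y - x| by near: y.
  apply; rewrite mulrC -ler_pdivlMr// distrC; near: y.
  by apply: cvgr_dist_le; [exact: cvg_id|exact: divr_gt0].
apply: (proj1 (near_differentiable (L := I \o 'd h x) cL _)) => e e0.
(* [k] bounds the norm of [I]; in [C + 1], the [C] pays for the remainder of [f] and the 1 for that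
   of [h]. *)
have e1 : 0 < e / (k * (C + 1)).
  by rewrite divr_gt0// mulr_gt0// addr_gt0.
have fe := differentiable_near (df (g x)) e1.
have hU : \forall y \near x, U y by exact: open_nbhs_nbhs.
near=> y.
have Uy : U y by near: y.
have f1 : `|f (g y) - f (g x) - 'd f (g x) (g y - g x)| <=
    e / (k * (C + 1)) * `|g y - g x|.
  by near: y; exact: gx fe.
have h1 : `|h y - h x - 'd h x (y - x)| <= e / (k * (C + 1)) * `|y - x|.
  by near: y; exact: differentiable_near.
have g1 : `|g y - g x| <= C * `|y - x| by near: y.
have -> : g y - g x - (I \o 'd h x) (y - x) =
    I ('d f (g x) (g y - g x) - 'd h x (y - x)) by rewrite IB IK.
apply: le_trans (kI _) _; rewrite mulrC -ler_pdivlMr//.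
rewrite !fgh// in f1.
apply: (@le_trans _ _ (e / (k * (C + 1)) * `|g y - g x| +
                       e / (k * (C + 1)) * `|y - x|)).
  apply: le_trans (lerD f1 h1); rewrite -[leLHS]normrN.
  apply: le_trans (ler_normB _ _); rewrite le_eqVlt; apply/orP; left; apply/eqP.
  by congr `|_|; rewrite opprB opprD opprK addrACA subrr add0r addrC.
rewrite -mulrDr -ler_pdivlMl//.
apply: (@le_trans _ _ ((C + 1) * `|y - x|)); first by rewrite mulrDl mul1r lerD2r.
rewrite le_eqVlt; apply/orP; left; apply/eqP.
have C1 : C + 1 != 0 by rewrite gt_eqF// addr_gt0.
by field; rewrite C1 !gt_eqF.
Unshelve. all: by end_near. Qed.

(** Bootstrap: the derivative of [g] is ['D_v h] times the inverse of the matrix of ['d f] at [g x],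
    an expression as regular as [g] itself, so order [k] for [g] gives order [k.+1]. *)
Lemma smooth_on_inverse : smooth_on U g.
Proof.
have df X : differentiable f X by exact: (smooth_on_differentiable sf).
have dg x : U x -> differentiable g x by exact: g_differentiable.
elim=> [|k IH]; first by move=> x /dg/differentiable_continuous.
split=> // v.
have Dh : iter_diff k U ('D_v h) by exact: smooth_on_derive.
have iJ : iter_diff k setT (fun X => lin_mx ('d f X)).
  apply/iter_diff_mxP => [|i j]; first exact: openT.
  have : iter_diff k setT (fun X => ('D_(vec_mx (delta_mx 0 i)) f X)).
    exact: smooth_on_derive.
  move/(iter_diff_linear_comp openT
    (@mx_linear_continuous R _ _ _ (coord_mx 0 j \o mxvec))).
  apply: iter_diff_eq => [|X _ /=]; first exact: openT.
  by rewrite /coord_mx /lin_mx /lin1_mx mxE /= deriveE.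
have H : iter_diff k U (fun x => vec_mx
    (mxvec ('D_v h x) *m invmx (lin_mx ('d f (g x))))).
  have I1 : iter_diff k U (fun x => invmx (lin_mx ('d f (g x)))).
    apply: iter_diff_invmx => // [x Ux|]; first exact: expanding_lin_mx_unit.
    exact: (iter_diff_comp oU openT _ iJ IH).
  apply: (iter_diff_linear_comp oU (L := vec_mx)).
    exact: mx_linear_continuous.
  apply/iter_diff_mxP => // i j.
  have : iter_diff k U (fun x => \sum_l mxvec ('D_v h x) i l *
       invmx (lin_mx ('d f (g x))) l j).
    apply: iter_diff_sum => // l _; apply: iter_diffM => //.
      exact: (iter_diff_linear_comp oU
        (@mx_linear_continuous R _ _ _ (coord_mx i l \o mxvec)) Dh).
    by have /(iter_diff_mxP _ _ oU) := I1; exact.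
  by apply: iter_diff_eq => // x _; rewrite mxE.
apply: iter_diff_eq H => // x Ux.
have -> : 'D_v h x = 'd f (g x) ('D_v g x).
  have -> : 'D_v h x = 'D_v (f \o g) x.
    apply: near_eq_derive.
    by apply: (open_eq_near oU Ux) => y Uy /=; rewrite fgh.
  rewrite (deriveE _ (differentiable_comp (dg x Ux) (df _))).
  by rewrite (diff_comp (dg x Ux) (df _)) (deriveE _ (dg x Ux)).
rewrite -mul_vec_lin mulmxK ?mxvecK//.
exact: expanding_lin_mx_unit.
Qed.

End InverseFunction.

(** * The real spectral theorem *)

Section Spectral.
Variable R : rcfType.

(** An eigenvalue [a] exists over the complex numbers. With [w] the conjugate of the eigenvector
    [v], evaluating v A w^T from either side gives a |v|^2 and conj(a) |v|^2, so [a] is real, and it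
    is a root of the real characteristic polynomial. *)
Lemma sym_eigenvalue n (A : 'M[R]_n.+1) : A^T = A -> exists a, eigenvalue A a.
Proof.
move=> AT; pose AC := map_mx (real_complex R) A.
have [a /[dup] ea /eigenvalueP[v va v0]] := eigenvalue_closed AC isT.
pose w := map_mx (@Num.conj _) v.
have wA : w *m AC = a^* *: w.
  have <- : map_mx (@Num.conj _) AC = AC.
    by apply/matrixP => i j; rewrite !mxE conj_Creal// complex_real.
  by rewrite -map_mxM va map_mxZ.
have s0 : (v *m w^T) 0 0 != 0.
  have -> : (v *m w^T) 0 0 = \sum_i `|v 0 i| ^+ 2.
    by rewrite mxE; apply: eq_bigr => i _; rewrite !mxE normCK.
  rewrite psumr_neq0; last by move=> i _; rewrite exprn_ge0.
  have [i vi] : exists i, v 0 i != 0.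
    apply/existsP; apply: contraNT v0; rewrite negb_exists => /forallP H.
    by apply/eqP/rowP => i; rewrite mxE; have := H i; rewrite negbK => /eqP.
  by apply/hasP; exists i; rewrite ?mem_index_enum//= exprn_gt0// normr_gt0.
have aR : a^* = a.
  apply: (mulIf s0).
  have -> : a * (v *m w^T) 0 0 = (v *m AC *m w^T) 0 0.
    by rewrite va -scalemxAl [RHS]mxE.
  have -> : v *m AC *m w^T = (w *m AC *m v^T)^T.
    rewrite !trmx_mul !trmxK mulmxA; congr (_ *m _ *m _).
    by apply/matrixP => i j; have /matrixP/(_ i j) := AT; rewrite !mxE => ->.
  by rewrite wA -scalemxAl linearZ /= trmx_mul trmxK [RHS]mxE.
have /CrealP/complex_realP : a^* = a by [].
case=> x ax; exists x; move: ea.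
by rewrite !eigenvalue_root_char /AC -map_char_poly ax fmorph_root.
Qed.

(** The Householder reflection in the hyperplane orthogonal to [u - e] exchanges [u] and [e]; the
    identity serves when they coincide. *)
Lemma reflection_to n (u : 'rV[R]_n.+1) : u *m u^T = 1%:M ->
  exists H : 'M[R]_n.+1, [/\ H^T = H, H *m H = 1%:M & row 0 H = u].
Proof.
move=> u1; pose e : 'rV[R]_n.+1 := delta_mx 0 0; pose w := u - e.
have e1 : e *m e^T = 1%:M.
  by apply/matrixP => i j; rewrite !ord1 trmx_delta mul_delta_mx !mxE.
have [w0|w0] := eqVneq w 0.
  exists 1%:M; rewrite trmx1 mulmx1; split => //.
  by rewrite rowE mulmx1; apply/esym/eqP; rewrite -subr_eq0 -/w w0.
pose s := (w *m w^T) 0 0.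
have sE : w *m w^T = s%:M by rewrite [LHS]mx11_scalar.
have s0 : s != 0.
  have -> : s = \sum_i w 0 i ^+ 2.
    by rewrite /s mxE; apply: eq_bigr => i _; rewrite [w^T _ _]mxE.
  rewrite psumr_neq0; last by move=> i _; rewrite sqr_ge0.
  have [i wi] : exists i, w 0 i != 0.
    apply/existsP; apply: contraNT w0; rewrite negb_exists => /forallP H.
    by apply/eqP/rowP => i; rewrite [RHS]mxE; have := H i; rewrite negbK => /eqP.
  by apply/hasP; exists i; rewrite ?mem_index_enum//= exprn_even_gt0.
have eu : e *m u^T = u *m e^T.
  by rewrite [LHS]mx11_scalar -[LHS]tr_scalar_mx -mx11_scalar trmx_mul trmxK.
pose c := (e *m u^T) 0 0; have cE : e *m u^T = c%:M by rewrite [LHS]mx11_scalar.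
have sc : s = 2 - 2 * c.
  rewrite /s /w linearB /= mulmxBr !mulmxBl u1 e1 -eu cE !mxE /=; ring.
exists (1%:M - (2 / s) *: (w^T *m w)); split.
- by rewrite linearB linearZ /= trmx1 trmx_mul trmxK.
- rewrite mulmxBr mulmx1 mulmxBl mul1mx -!scalemxAl -!scalemxAr.
  rewrite mulmxA -[w^T *m w *m w^T]mulmxA sE mul_mx_scalar -scalemxAl !scalerA.
  have -> : 2 / s * (2 / s * s) = 2 / s + 2 / s by field.
  rewrite scalerDl; set X := (2 / s) *: _.
  by rewrite [X - (X + X)](_ : _ = - X) ?opprK ?subrK// opprD addNKr.
- have ew : e *m w^T = (c - 1)%:M.
    by rewrite /w linearB /= mulmxBr cE e1 -raddfB.
  rewrite rowE -/e (mulmxBr e 1%:M) mulmx1 -scalemxAr mulmxA ew.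
  rewrite mul_scalar_mx scalerA.
  have -> : 2 / s * (c - 1) = -1.
    by apply: (mulIf s0); rewrite mulrAC divfK// sc; ring.
  by rewrite scaleN1r opprK /w addrC subrK.
Qed.

Lemma block_spectral n a (A Q : 'M[R]_n) d :
  Q *m Q^T = 1%:M -> A = Q^T *m diag_mx d *m Q ->
  exists (P : 'M[R]_(1 + n)) (d' : 'rV[R]_(1 + n)),
    P *m P^T = 1%:M /\ block_mx a%:M 0 0 A = P^T *m diag_mx d' *m P.
Proof.
move=> Q1 ->; exists (block_mx 1%:M 0 0 Q), (row_mx a%:M d).
rewrite diag_mx_row tr_block_mx !trmx0 trmx1 !mulmx_block.
rewrite !(mulmx0, mul0mx, mul1mx, mulmx1, addr0, add0r) Q1 -scalar_mx_block.
split=> //; congr block_mx.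
by apply/matrixP => i j; rewrite !mxE !ord1 eqxx.
Qed.

(** Conjugating by a reflection that sends the first basis vector to a unit eigenvector clears the
    first row outside the corner and, by symmetry, the first column; induction applies to the
    remaining block. *)
Theorem sym_spectral n (A : 'M[R]_n) : A^T = A ->
  exists (P : 'M[R]_n) (d : 'rV[R]_n),
    P *m P^T = 1%:M /\ A = P^T *m diag_mx d *m P.
Proof.
elim: n A => [|n IH] A AT.
  by exists 1%:M, 0; split; [rewrite mul1mx trmx1|rewrite [A]flatmx0 [RHS]flatmx0].
have [a /eigenvalueP[v va v0]] := sym_eigenvalue AT.
pose s := (v *m v^T) 0 0.
have sE : v *m v^T = s%:M by rewrite [LHS]mx11_scalar.
have s0 : 0 < s.
  have -> : s = \sum_i v 0 i ^+ 2.
    by rewrite /s mxE; apply: eq_bigr => i _; rewrite mxE.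
  rewrite lt_def sumr_ge0 ?andbT; last by move=> i _; rewrite sqr_ge0.
  rewrite psumr_neq0; last by move=> i _; rewrite sqr_ge0.
  have [i wi] : exists i, v 0 i != 0.
    apply/existsP; apply: contraNT v0; rewrite negb_exists => /forallP H.
    by apply/eqP/rowP => i; rewrite [RHS]mxE; have := H i; rewrite negbK => /eqP.
  by apply/hasP; exists i; rewrite ?mem_index_enum//= exprn_even_gt0.
pose u := (Num.sqrt s)^-1 *: v.
have u1 : u *m u^T = 1%:M.
  rewrite /u linearZ /= -scalemxAr -scalemxAl scalerA sE -invfM -expr2.
  by rewrite sqr_sqrtr ?ltW// scale_scalar_mx mulVf ?gt_eqF.
have ua : u *m A = a *: u by rewrite /u -scalemxAl va !scalerA mulrC.
have [H [HT HH Hu]] := reflection_to u1.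
pose B : 'M[R]_(1 + n) := H *m A *m H.
have BT : B^T = B by rewrite /B !trmx_mul HT AT mulmxA.
have B0 : row 0 B = a *: delta_mx 0 0.
  rewrite /B rowE 2!mulmxA -rowE Hu ua -scalemxAl; congr (_ *: _).
  by rewrite -Hu rowE -mulmxA HH mulmx1.
have Bu : ursubmx B = 0.
  apply/matrixP => i j; have /rowP/(_ (rshift 1 j)) := B0.
  by rewrite !mxE !ord1 (_ : lshift n 0 = 0) ?mulr0//; exact: val_inj.
have Bl : dlsubmx B = 0 by rewrite -[B]BT -trmx_ursub Bu trmx0.
have Ba : ulsubmx B = a%:M.
  apply/matrixP => i j; have /rowP/(_ 0) := B0; rewrite !ord1 !mxE eqxx mulr1 => <-.
  have l0 : lshift n (0 : 'I_1) = 0 by exact: val_inj.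
  by rewrite !l0 /= ?mulr1n.
have BE : B = block_mx a%:M 0 0 (drsubmx B) by rewrite -[LHS]submxK Bu Bl Ba.
have DT : (drsubmx B)^T = drsubmx B by rewrite trmx_drsub BT.
have [Q [d [Q1 QE]]] := IH _ DT.
have [Q' [d' [Q1' QE']]] := block_spectral a Q1 QE.
exists (Q' *m H), d'; split.
  by rewrite trmx_mul HT mulmxA -[Q' *m H *m H]mulmxA HH mulmx1.
have -> : A = H *m B *m H by rewrite /B !mulmxA HH mul1mx -mulmxA HH mulmx1.
rewrite trmx_mul HT -!mulmxA; congr (_ *m _); rewrite !mulmxA; congr (_ *m _).
by rewrite -QE' -BE.
Qed.

(** The matrix [W] relates the two eigenbases, and its squared entries are nonnegative weights.
    Through this formula a trace inequality is checked one pair of eigenvalues at a time. *)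
Lemma mxtrace_spectral n (P Q : 'M[R]_n) (a b : 'rV[R]_n) :
  \tr ((P^T *m diag_mx a *m P) *m (Q^T *m diag_mx b *m Q)) =
  \sum_i \sum_j a 0 i * b 0 j * (P *m Q^T) i j ^+ 2.
Proof.
set W := P *m Q^T.
have -> : \tr ((P^T *m diag_mx a *m P) *m (Q^T *m diag_mx b *m Q)) =
          \tr (diag_mx a *m W *m diag_mx b *m W^T).
  rewrite -!mulmxA mxtrace_mulC -!mulmxA /W trmx_mul trmxK.
  by rewrite !mulmxA.
rewrite /mxtrace; apply: eq_bigr => i _; rewrite mxE; apply: eq_bigr => j _.
rewrite -[diag_mx a *m W *m _]mulmxA mul_diag_mx mul_mx_diag !mxE; ring.
Qed.

End Spectral.

(** * Smoothness of the matrix exponential *)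

Lemma seq_cvg_unique {R : realType} {W : normedModType R} (u : nat -> W) (a b : W) :
  u n @[n --> \oo] --> a -> u n @[n --> \oo] --> b -> a = b.
Proof. by move=> ua ub; exact: (cvg_unique _ ua ub). Qed.

(* Joins the complete and the normed module structures of matrices. *)
HB.instance Definition _ (R : realType) m n := Complete.on 'M[R]_(m, n).

Section MatrixNorm.
Context {R : realType}.

Lemma mx_norm_le m n (A : 'M[R]_(m, n)) (c : R) : 0 <= c ->
  (forall i j, `|A i j| <= c) -> `|A| <= c.
Proof.
by move=> c0 H; rewrite [leLHS]/Num.Def.normr/= mx_normrE bigmax_le// => -[i j].
Qed.

Lemma mx_norm_ge m n (A : 'M[R]_(m, n)) i j : `|A i j| <= `|A|.
Proof.
by rewrite [leRHS]/Num.Def.normr/= mx_normrE; exact: (le_bigmax _ _ (i, j)).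
Qed.

(** The norm is the largest absolute value of an entry, submultiplicative only up to the inner
    dimension; hence the factors n in the exponential bounds. *)
Lemma mx_norm_mul m n p (A : 'M[R]_(m, n)) (B : 'M[R]_(n, p)) :
  `|A *m B| <= n%:R * `|A| * `|B|.
Proof.
apply: mx_norm_le => [|i j]; first by rewrite !mulr_ge0.
rewrite mxE (le_trans (ler_norm_sum _ _ _))//.
apply: (@le_trans _ _ (\sum_(k < n) `|A| * `|B|)).
  by apply: ler_sum => k _; rewrite normrM ler_pM ?mx_norm_ge.
by rewrite sumr_const card_ord -mulrA mulr_natl.
Qed.

Lemma mxtrace_norm_le n (A : 'M[R]_n) : `|\tr A| <= n%:R * `|A|.
Proof.
rewrite (le_trans (ler_norm_sum _ _ _))//.
apply: (@le_trans _ _ (\sum_(k < n) `|A|)).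
  by apply: ler_sum => k _; exact: mx_norm_ge.
by rewrite sumr_const card_ord mulr_natl.
Qed.

Lemma mx_norm_expr n (A : 'M[R]_n) k : `|A ^+ k| <= (n%:R * `|A|) ^+ k.
Proof.
elim: k => [|k IH].
  rewrite !expr0; apply: mx_norm_le => // i j.
  by rewrite mxE; case: (i == j); rewrite ?normr1 ?normr0.
rewrite !exprS (le_trans (mx_norm_mul _ _))// ler_wpM2l// mulr_ge0//.
Qed.

Lemma block_mx_norm_le m n p q (A : 'M[R]_(m, p)) (B : 'M[R]_(m, q))
    (C : 'M[R]_(n, p)) (D : 'M[R]_(n, q)) (c : R) :
  `|A| <= c -> `|B| <= c -> `|C| <= c -> `|D| <= c -> `|block_mx A B C D| <= c.
Proof.
move=> Ac Bc Cc Dc; apply: mx_norm_le => [|i j]; first exact: le_trans Ac.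
by case: (split_ordP i) => k ->; case: (split_ordP j) => l ->;
   rewrite ?block_mxEul ?block_mxEur ?block_mxEdl ?block_mxEdr;
   apply: le_trans (mx_norm_ge _ _ _) _.
Qed.

End MatrixNorm.

Fact ursubmx_is_linear (R : realType) m1 m2 n1 n2 :
  linear (@ursubmx R m1 m2 n1 n2).
Proof. by move=> a A B; apply/matrixP => i j; rewrite !mxE. Qed.

HB.instance Definition _ (R : realType) m1 m2 n1 n2 :=
  GRing.isLinear.Build R 'M[R]_(m1 + m2, n1 + n2) 'M[R]_(m1, n2) _
    (@ursubmx R m1 m2 n1 n2) (@ursubmx_is_linear R m1 m2 n1 n2).

Section MatrixExponential.
Context {R : realType}.

Lemma expmx_normed_cvg n (A : 'M[R]_n) :
  cvgn [normed series (fun k : nat => (k`!%:R : R)^-1 *: A ^+ k)] /\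
  limn [normed series (fun k : nat => (k`!%:R : R)^-1 *: A ^+ k)] <=
    expR (n%:R * `|A|).
Proof.
have H k : `|(k`!%:R : R)^-1 *: A ^+ k| <= exp_coeff (n%:R * `|A|) k.
  rewrite normrZ ger0_norm ?invr_ge0// exp_coeffE ler_wpM2l ?invr_ge0//.
  exact: mx_norm_expr.
have C : cvgn [normed series (fun k : nat => (k`!%:R : R)^-1 *: A ^+ k)].
  apply: (@series_le_cvg R _ (exp_coeff (n%:R * `|A|))) => //.
  - by move=> k /=.
  - by move=> k; rewrite exp_coeff_ge0// mulr_ge0.
  - exact: is_cvg_series_exp_coeff.
split=> //; apply: lim_series_le => //; exact: is_cvg_series_exp_coeff.
Qed.

Lemma expmx_cvg n (A : 'M[R]_n) :
  series (fun k : nat => (k`!%:R : R)^-1 *: A ^+ k) @ \oo --> expmx A.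
Proof.
have := normed_cvg (proj1 (expmx_normed_cvg A)).
by rewrite /expmx; apply.
Qed.

Lemma expmx_norm_le n (A : 'M[R]_n) : `|expmx A| <= expR (n%:R * `|A|).
Proof.
have [C B] := expmx_normed_cvg A.
by apply: le_trans B; exact: lim_series_norm.
Qed.

Lemma expmx_linear_cvg n (W : normedModType R) (L : {linear 'M[R]_n -> W}) A :
  series (fun k : nat => (k`!%:R : R)^-1 *: L (A ^+ k)) @ \oo --> L (expmx A).
Proof.
have -> : series (fun k : nat => (k`!%:R : R)^-1 *: L (A ^+ k)) =
    L \o series (fun k : nat => (k`!%:R : R)^-1 *: A ^+ k).
  apply/funext => N /=; rewrite /series /= linear_sum.
  by apply: eq_bigr => k _; rewrite linearZ.
by apply: continuous_cvg; [exact: mx_linear_continuous|exact: expmx_cvg].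
Qed.

Lemma expmx_linear_eq m n (W : normedModType R) (L : {linear 'M[R]_m -> W})
    (L' : {linear 'M[R]_n -> W}) A B :
  (forall k, L (A ^+ k) = L' (B ^+ k)) -> L (expmx A) = L' (expmx B).
Proof.
move=> LL; have := @expmx_linear_cvg _ _ L A.
under eq_fun do rewrite LL.
by move=> cL; exact: (seq_cvg_unique cL (@expmx_linear_cvg _ _ L' B)).
Qed.

Section Divided.
Variable n : nat.
Implicit Types X Y Z : 'M[R]_n.

(** The sum of X^i Z Y^j over i + j + 1 = k, a noncommutative divided difference of the k-th power:
    linear in [Z], and telescoping to X^k - Y^k when Z = X - Y. *)
Fixpoint pow_div X Y Z k : 'M[R]_n :=
  if k is k'.+1 then X *m pow_div X Y Z k' + Z *m Y ^+ k' else 0.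

Definition exp_block X Y Z : 'M[R]_(n + n) := block_mx X Z 0 Y.

Lemma exp_block_pow X Y Z k :
  exp_block X Y Z ^+ k = block_mx (X ^+ k) (pow_div X Y Z k) 0 (Y ^+ k).
Proof.
elim: k => [|k IH]; first by rewrite !expr0 /= -scalar_mx_block.
rewrite exprS IH -mulmxE mulmx_block.
by rewrite !mulmx0 !mul0mx !addr0 add0r !mulmxE -!exprS.
Qed.

Definition exp_div X Y Z : 'M[R]_n := ursubmx (expmx (exp_block X Y Z)).

Lemma exp_div_cvg X Y Z :
  series (fun k : nat => (k`!%:R : R)^-1 *: pow_div X Y Z k) @ \oo -->
  exp_div X Y Z.
Proof.
have := @expmx_linear_cvg (n + n) 'M[R]_n (@ursubmx R n n n n) (exp_block X Y Z).
by under eq_fun do rewrite /= exp_block_pow block_mxKur.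
Qed.

Lemma exp_div_linear X Y : linear (exp_div X Y).
Proof.
have pL k : linear (pow_div X Y ^~ k).
  elim: k => [|k IH] a Z Z' /=; first by rewrite scaler0 addr0.
  rewrite IH mulmxDr mulmxDl -scalemxAr -scalemxAl scalerDr.
  by rewrite addrACA.
move=> a Z Z'.
apply: seq_cvg_unique (@exp_div_cvg X Y _) _.
rewrite [X in X @ _ --> _](_ : _ = a \*: series (fun k => (k`!%:R : R)^-1 *: pow_div X Y Z k)
  + series (fun k => (k`!%:R : R)^-1 *: pow_div X Y Z' k)).
  by apply: cvgD; [apply: cvgZl_tmp|]; exact: exp_div_cvg.
apply/funext => N; rewrite !fctE /series /= scaler_sumr -big_split /=.
by apply: eq_bigr => k _; rewrite pL scalerDr !scalerA mulrC.
Qed.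

HB.instance Definition _ X Y := GRing.isLinear.Build R 'M[R]_n 'M[R]_n _
  (exp_div X Y) (@exp_div_linear X Y).

Lemma expmx_sub X Y : expmx X - expmx Y = exp_div X Y (X - Y).
Proof.
have pE k : pow_div X Y (X - Y) k = X ^+ k - Y ^+ k.
  elim: k => [|k IH] /=; first by rewrite !expr0 subrr.
  by rewrite IH mulmxBr mulmxBl addrA subrK !mulmxE -!exprS.
apply/esym/(seq_cvg_unique (@exp_div_cvg X Y _)).
rewrite [X in X @ _ --> _](_ : _ = series (fun k => (k`!%:R : R)^-1 *: X ^+ k)
   - series (fun k => (k`!%:R : R)^-1 *: Y ^+ k)).
  by apply: cvgB; exact: expmx_cvg.
apply/funext => N; rewrite !fctE /series /= -sumrB.
by apply: eq_bigr => k _; rewrite pE scalerBr.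
Qed.

Lemma exp_block_norm_le X Y Z (r : R) : `|X| <= r -> `|Y| <= r -> `|Z| <= r ->
  `|exp_block X Y Z| <= r.
Proof.
by move=> Xr Yr Zr; apply: block_mx_norm_le => //; rewrite normr0 (le_trans _ Xr).
Qed.

Lemma ursubmx_norm_le (A : 'M[R]_(n + n)) : `|ursubmx A| <= `|A|.
Proof. by apply: mx_norm_le => // i j; rewrite !mxE; exact: mx_norm_ge. Qed.

(** By linearity of [exp_div X Y], the argument X - Y may be scaled to norm 1, which [1 <= r] keeps
    within the bound on the blocks. The constant is the norm bound for an exponential of size n +
    n. *)
Lemma expmx_lipschitz X Y (r : R) : 1 <= r -> `|X| <= r -> `|Y| <= r ->
  `|expmx X - expmx Y| <= expR ((n + n)%:R * r) * `|X - Y|.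
Proof.
move=> r1 Xr Yr; rewrite expmx_sub.
have [->|XY] := eqVneq (X - Y) 0; first by rewrite linear0 !normr0 mulr0.
have t0 : 0 < `|X - Y| by rewrite normr_gt0.
rewrite -[X - Y in leLHS](scalerKV (lt0r_neq0 t0)) linearZ /= normrZ normr_id.
rewrite mulrC ler_pM2r// (le_trans (ursubmx_norm_le _))//.
rewrite (le_trans (expmx_norm_le _))// ler_expR ler_wpM2l//.
apply: exp_block_norm_le => //; rewrite normrZ normfV normr_id mulVf//.
exact: lt0r_neq0.
Qed.

End Divided.

(** With H = Y - A, the remainder is [exp_div Y A H - exp_div A A H], that is, |H| times a corner of
    the difference of two block exponentials whose arguments differ by [H] in a single block. The
    Lipschitz bound [K], taken in size n + n, makes it O(|H|^2). *)
Lemma expmx_differentiable n (A : 'M[R]_n) :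
  differentiable (@expmx R n) A /\ 'd (@expmx R n) A = exp_div A A :> (_ -> _).
Proof.
pose r := `|A| + 1; pose K := expR ((n + n + (n + n))%:R * r).
have r1 : 1 <= r by rewrite lerDr.
have K0 : 0 < K by exact: expR_gt0.
apply: (@near_differentiable _ _ _ _ _ (exp_div A A : {linear _ -> _})).
  exact: mx_linear_continuous.
move=> e e0; near=> Y.
have Y1 : `|Y - A| <= 1.
  by rewrite distrC; near: Y; apply: cvgr_dist_le => //; exact: cvg_id.
have Ye : `|Y - A| <= e / K.
  rewrite distrC; near: Y; apply: cvgr_dist_le; first exact: cvg_id.
  exact: divr_gt0.
have Yr : `|Y| <= r.
  by rewrite -[Y](subrK A) (le_trans (ler_normD _ _))// addrC lerD2l.
rewrite expmx_sub; set H := Y - A.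
have [->|H0] := eqVneq H 0; first by rewrite !linear0 ?subr0 ?addr0 !normr0 mulr0.
have t0 : 0 < `|H| by rewrite normr_gt0.
set Z := `|H|^-1 *: H.
have Z1 : `|Z| <= r.
  by rewrite normrZ normfV normr_id mulVf// lt0r_neq0.
have HE : H = `|H| *: Z by rewrite scalerKV// lt0r_neq0.
have E C : exp_div C A H = `|H| *: exp_div C A Z by rewrite {1}HE linearZ.
rewrite [X in `|X|](_ : _ = `|H| *: (exp_div Y A Z - exp_div A A Z)); last first.
  by rewrite scalerBr -!E.
rewrite normrZ normr_id mulrC ler_pM2r//.
rewrite /exp_div -linearB (le_trans (ursubmx_norm_le _))//.
apply: (@le_trans _ _ (K * `|exp_block Y A Z - exp_block A A Z|)).
  by apply: expmx_lipschitz => //; apply: exp_block_norm_le => //; rewrite lerDl.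
rewrite mulrC -ler_pdivlMr//; apply: le_trans Ye.
rewrite /exp_block opp_block_mx add_block_mx !subrr.
by apply: block_mx_norm_le; rewrite ?normr0.
Unshelve. all: by end_near. Qed.

Lemma expmx_smooth n : smooth_on setT (@expmx R n).
Proof.
(* The size is generalised in the induction: a derivative in size n is a block of an exponential of
   size n + n. *)
move=> k; elim: k n => [|k IH] n.
  move=> A _; apply/differentiable_continuous.
  by have [] := expmx_differentiable A.
split=> [A _|v]; first by have [] := expmx_differentiable A.
have H : iter_diff k setT (fun A : 'M[R]_n => exp_block A A v).
  apply/iter_diff_mxP => [|i j]; first exact: openT.
  have I (a b : 'I_n) : iter_diff k setT (fun A : 'M[R]_n => A a b).
    exact: iter_diff_coord.
  case: (split_ordP i) => i' ->; case: (split_ordP j) => j' ->.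
  - by apply: iter_diff_eq (I i' j') => [|A _]; rewrite ?block_mxEul//; exact: openT.
  - apply: iter_diff_eq (iter_diff_cst k setT (v i' j')) => [|A _]; first exact: openT.
    by rewrite block_mxEur.
  - apply: iter_diff_eq (iter_diff_cst k setT (0 : R)) => [|A _]; first exact: openT.
    by rewrite block_mxEdl mxE.
  - by apply: iter_diff_eq (I i' j') => [|A _]; rewrite ?block_mxEdr//; exact: openT.
have := iter_diff_comp openT openT (fun x _ => I) (IH (n + n)%N) H.
move/(iter_diff_linear_comp openT (@mx_linear_continuous R (n + n) (n + n) 'M[R]_n (@ursubmx R n n n n))).
apply: iter_diff_eq => [|A _ /=]; first exact: openT.
have [dA dE] := expmx_differentiable A.
by rewrite deriveE// dE.
Qed.

End MatrixExponential.

(** * Trace inequalities for the exponential of symmetric matrices *)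

Section SpectralForm.
Context {R : realType} {n : nat}.
Implicit Types (P Q : 'M[R]_n) (a b d : 'rV[R]_n) (A X Y : 'M[R]_n).

Definition spectral_form P d : 'M[R]_n := P^T *m diag_mx d *m P.
Local Notation sp := spectral_form.

Lemma spectral_form_sym P d : sym (sp P d).
Proof. by rewrite /sym /= /sp !trmx_mul trmxK tr_diag_mx mulmxA. Qed.

Lemma spectral_formM P a b : P *m P^T = 1%:M ->
  sp P a *m sp P b = sp P (\row_i (a 0 i * b 0 i)).
Proof.
move=> PP; rewrite /sp !mulmxA -[_ *m P *m P^T]mulmxA PP mulmx1.
congr (_ *m _); rewrite -!mulmxA mulmx_diag; congr (_ *m diag_mx _).
Qed.

Lemma spectral_form1 P : P *m P^T = 1%:M -> sp P (const_mx 1) = 1%:M.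
Proof.
by move=> /mulmx1C PP; rewrite /sp diag_const_mx mulmx1.
Qed.

Lemma mxtrace_spectral_form P d : P *m P^T = 1%:M -> \tr (sp P d) = \sum_i d 0 i.
Proof.
by move=> PP; rewrite /sp -mulmxA mxtrace_mulC -mulmxA PP mulmx1 mxtrace_diag.
Qed.

Lemma quad_spectral_form P d (x : 'cV[R]_n) :
  (x^T *m sp P d *m x) 0 0 = \sum_i d 0 i * (P *m x) i 0 ^+ 2.
Proof.
rewrite /sp !mulmxA -[x^T *m P^T]trmx_mul -!mulmxA.
move: (P *m x) => y; rewrite mul_diag_mx mxE.
by apply: eq_bigr => i _; rewrite !mxE; ring.
Qed.

Lemma spd_spectral_form P d : P *m P^T = 1%:M ->
  spd (sp P d) <-> forall i, 0 < d 0 i.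
Proof.
move=> PP; have PP' := mulmx1C PP; split=> [[_ H] i|d0].
  have := H (P^T *m delta_mx i 0); rewrite quad_spectral_form mulmxA PP mul1mx.
  rewrite (bigD1 i)//= big1 => [|j ji]; last first.
    by rewrite mxE (negbTE ji) expr0n mulr0.
  rewrite addr0 mxE !eqxx expr1n mulr1; apply.
  apply/eqP => /(congr1 (mulmx P)); rewrite mulmxA PP mul1mx mulmx0.
  by move/matrixP/(_ i 0)/eqP; rewrite !mxE !eqxx oner_eq0.
split=> [|x x0]; first exact: spectral_form_sym.
rewrite quad_spectral_form.
have : P *m x != 0.
  apply: contraNneq x0 => /(congr1 (mulmx P^T)).
  by rewrite mulmxA PP' mul1mx mulmx0 => ->.
move=> /cV0Pn[i Pxi]; rewrite (bigD1 i)//= ltr_pwDl//.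
  by rewrite mulr_gt0// exprn_even_gt0.
by apply: sumr_ge0 => j _; rewrite mulr_ge0 ?sqr_ge0// ltW.
Qed.

Lemma expmx_diag d : expmx (diag_mx d) = diag_mx (map_mx expR d).
Proof.
have dk k : diag_mx d ^+ k = diag_mx (map_mx (fun x => x ^+ k) d).
  elim: k => [|k IH].
    by rewrite expr0; apply/matrixP => i j; rewrite !mxE expr0.
  rewrite exprS IH -mulmxE mulmx_diag; congr diag_mx.
  by apply/rowP => i; rewrite !mxE exprS.
apply/matrixP => i j.
have := @expmx_linear_cvg R n R (coord_mx i j) (diag_mx d).
rewrite [in X in _ -> X]mxE [in X in _ -> X]mxE.
have [ij|ij] := eqVneq i j.
  rewrite mulr1n => h; apply: seq_cvg_unique h _.
  rewrite [X in X @ _](_ : _ = series (exp_coeff (d 0 i))).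
    exact: is_cvg_series_exp_coeff.
  apply/funext => N; rewrite /series /=; apply: eq_bigr => k _.
  by rewrite dk exp_coeffE /coord_mx !mxE -ij eqxx mulr1n.
rewrite mulr0n => h; apply: seq_cvg_unique h _.
rewrite [X in X @ _](_ : _ = cst 0); first exact: cvg_cst.
apply/funext => N; rewrite /series /= big1// => k _.
by rewrite dk /coord_mx !mxE (negbTE ij) mulr0n scaler0.
Qed.

Lemma expmx_spectral_form P d : P *m P^T = 1%:M ->
  expmx (sp P d) = sp P (map_mx expR d).
Proof.
move=> PP; rewrite {2}/sp -expmx_diag.
have H k : sp P d ^+ k = P^T *m (diag_mx d ^+ k) *m P.
  elim: k => [|k IH]; first by rewrite !expr0 mulmx1 (mulmx1C PP).
  rewrite !exprS IH -!mulmxE /sp !mulmxA.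
  by rewrite -[_ *m P *m P^T]mulmxA PP mulmx1.
exact: (@expmx_linear_eq R n n 'M[R]_n idfun (mulmxr P \o mulmx P^T)).
Qed.

Lemma sym_spectral_form A : sym A ->
  exists P d, P *m P^T = 1%:M /\ A = sp P d.
Proof. by move=> /sym_spectral[P [d [PP AE]]]; exists P, d. Qed.

Lemma expmx_spd A : sym A -> spd (expmx A).
Proof.
move=> /sym_spectral_form[P [d [PP ->]]]; rewrite expmx_spectral_form//.
by apply/spd_spectral_form => // i; rewrite mxE expR_gt0.
Qed.

Lemma expmx_surj A : spd A -> exists2 X, sym X & expmx X = A.
Proof.
move=> /[dup] [[/sym_spectral_form[P [d [PP ->]]] _]].
move=> /(spd_spectral_form d PP) d0.
exists (sp P (map_mx (@ln R) d)); first exact: spectral_form_sym.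
rewrite expmx_spectral_form//; congr sp.
by apply/rowP => i; rewrite !mxE lnK// posrE.
Qed.

Lemma spectral_form_bound P d (r : R) i : P *m P^T = 1%:M -> 0 <= r ->
  \tr (sp P d *m sp P d) <= r ^+ 2 -> - r <= d 0 i.
Proof.
move=> PP r0; rewrite spectral_formM// mxtrace_spectral_form//.
rewrite (bigD1 i)//= mxE -expr2 => H.
have : d 0 i ^+ 2 <= r ^+ 2.
  apply: le_trans H; rewrite lerDl; apply: sumr_ge0 => j _.
  by rewrite mxE -expr2 sqr_ge0.
by rewrite -ler_sqrt ?sqr_ge0// !sqrtr_sqr (ger0_norm r0) ler_norml => /andP[].
Qed.

(** Traces involving X alone, Y alone or both become sums with the same weights; for those involving
    only one of them, the orthogonality of the other eigenbasis inserts the missing index. An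
    inequality between traces then follows from one between the coefficients [F i j]. *)
Let dsum (W : 'M[R]_n) (F : 'I_n -> 'I_n -> R) := \sum_i \sum_j F i j * W i j ^+ 2.

Let dsumD W F G : dsum W F + dsum W G = dsum W (fun i j => F i j + G i j).
Proof.
rewrite /dsum -big_split; apply: eq_bigr => i _; rewrite -big_split.
by apply: eq_bigr => j _; rewrite mulrDl.
Qed.

Let dsumN W F : - dsum W F = dsum W (fun i j => - F i j).
Proof.
rewrite /dsum -sumrN; apply: eq_bigr => i _; rewrite -sumrN.
by apply: eq_bigr => j _; rewrite mulNr.
Qed.

Let dsumZ W c F : c * dsum W F = dsum W (fun i j => c * F i j).
Proof.
rewrite /dsum mulr_sumr; apply: eq_bigr => i _; rewrite mulr_sumr.
by apply: eq_bigr => j _; rewrite mulrA.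
Qed.

Let dsum_ge0 W F : (forall i j, 0 <= F i j) -> 0 <= dsum W F.
Proof.
move=> F0; apply: sumr_ge0 => i _; apply: sumr_ge0 => j _.
by rewrite mulr_ge0// sqr_ge0.
Qed.

Let tr_dsum P Q a b :
  \tr (sp P a *m sp Q b) = dsum (P *m Q^T) (fun i j => a 0 i * b 0 j).
Proof. exact: mxtrace_spectral. Qed.

Let tr_dsuml P Q a : Q *m Q^T = 1%:M ->
  \tr (sp P a) = dsum (P *m Q^T) (fun i j => a 0 i).
Proof.
move=> QQ; rewrite -[sp P a]mulmx1 -(spectral_form1 QQ) tr_dsum.
apply: eq_bigr => i _; apply: eq_bigr => j _; by rewrite mxE mulr1.
Qed.

Let tr_dsumr P Q b : P *m P^T = 1%:M ->
  \tr (sp Q b) = dsum (P *m Q^T) (fun i j => b 0 j).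
Proof.
move=> PP; rewrite -[sp Q b]mul1mx -(spectral_form1 PP) tr_dsum.
apply: eq_bigr => i _; apply: eq_bigr => j _; by rewrite mxE mul1r.
Qed.

Let exp_scalar_mono (r x y : R) : - r <= x -> - r <= y ->
  expR (- r) * (x - y) ^+ 2 <= (expR x - expR y) * (x - y).
Proof.
wlog xy : x y / y <= x => [H|rx ry].
  move=> rx ry; have [/H|/ltW/H] := leP y x; first exact.
  by move=> /(_ ry rx); rewrite -sqrrN opprB -[leRHS]mulrNN !opprB.
rewrite expr2 mulrA ler_wpM2r ?subr_ge0//.
have -> : expR x - expR y = expR y * (expR (x - y) - 1).
  by rewrite mulrBr mulr1 -expRD (addrC y) subrK.
apply: ler_pM; rewrite ?expR_ge0 ?subr_ge0 ?ler_expR//.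
by rewrite lerBrDl expR_ge1Dx.
Qed.

Lemma expmx_strongly_monotone X Y (r : R) : sym X -> sym Y -> 0 <= r ->
  \tr (X *m X) <= r ^+ 2 -> \tr (Y *m Y) <= r ^+ 2 ->
  expR (- r) * \tr ((X - Y) *m (X - Y)) <=
  \tr ((expmx X - expmx Y) *m (X - Y)).
Proof.
move=> /sym_spectral_form[P [a [PP ->]]] /sym_spectral_form[Q [b [QQ ->]]] r0 Xr Yr.
rewrite !expmx_spectral_form//; set ea := map_mx _ a; set eb := map_mx _ b.
have E u v : \tr ((sp P u - sp Q v) *m (sp P a - sp Q b)) =
    dsum (P *m Q^T) (fun i j => (u 0 i - v 0 j) * (a 0 i - b 0 j)).
  rewrite mulmxBl !mulmxBr !linearB /= !spectral_formM//.
  rewrite (mxtrace_mulC (sp Q v) (sp P a)) !tr_dsum (tr_dsuml P _ QQ).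
  rewrite (tr_dsumr Q _ PP) !dsumN !dsumD.
  apply: eq_bigr => i _; apply: eq_bigr => j _; rewrite !mxE; ring.
rewrite !E dsumZ -subr_ge0 dsumN dsumD; apply: dsum_ge0 => i j.
rewrite subr_ge0 -expr2 !mxE; apply: exp_scalar_mono.
  exact: spectral_form_bound Xr.
exact: spectral_form_bound Yr.
Qed.

(** Klein's inequality: the scalar tangent line bound e^b >= e^a + e^a (b - a), summed with weights
    over the pairs of eigenvalues. *)
Lemma mxtrace_expmx_convex X Y : sym X -> sym Y ->
  \tr (expmx X) + \tr (expmx X *m (Y - X)) <= \tr (expmx Y).
Proof.
move=> /sym_spectral_form[P [a [PP ->]]] /sym_spectral_form[Q [b [QQ ->]]].
rewrite !expmx_spectral_form// mulmxBr linearB /= spectral_formM//.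
rewrite tr_dsum !(tr_dsuml P _ QQ) (tr_dsumr Q _ PP) -subr_ge0.
rewrite !dsumN !dsumD !dsumN !dsumD; apply: dsum_ge0 => i j; rewrite !mxE.
have := expR_ge1Dx (b 0 j - a 0 i).
rewrite -(ler_pM2l (expR_gt0 (a 0 i))) -expRD (addrC (a 0 i)) subrK => H.
by rewrite subr_ge0 (le_trans _ H)// le_eqVlt; apply/orP; left; apply/eqP; ring.
Qed.

(** For x >= 0, e^x is the square of e^(x/2) >= 1 + x/2, and (1 + x/2)^2 - 2 x = (1 - x/2)^2. *)
Let exp_scalar_coercive (x : R) : `|x| <= expR x - x.
Proof.
have [x0|x0] := leP 0 x; last by rewrite ltr0_norm// lerDr expR_ge0.
rewrite ger0_norm// lerBrDr.
have h : 1 + x / 2 <= expR (x / 2) by exact: expR_ge1Dx.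
have h0 : 0 <= 1 + x / 2 by rewrite addr_ge0// divr_ge0.
have -> : expR x = expR (x / 2) ^+ 2 by rewrite expr2 -expRD -splitr.
apply: le_trans (ler_pM h0 h0 h h).
by rewrite -subr_ge0 (_ : _ - _ = (1 - x / 2) ^+ 2) ?sqr_ge0//; field.
Qed.

(** Convexity at the diagonal part D of X: the first-order term tr (e^D (X - D)) vanishes because X
    - D has zero diagonal, so tr e^X is at least the sum of the e^(X_ii), and the scalar bound
    applies to each. *)
Lemma mxtrace_expmx_coercive X : sym X ->
  \sum_i `|X i i| <= \tr (expmx X) - \tr X.
Proof.
move=> sX; pose d : 'rV[R]_n := \row_i X i i.
have sD : sym (diag_mx d) by rewrite /sym /= tr_diag_mx.
have := mxtrace_expmx_convex sD sX; rewrite expmx_diag mul_diag_mx.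
rewrite [X in _ + X <= _](_ : _ = 0) ?addr0; last first.
  by rewrite /mxtrace big1// => i _; rewrite !mxE eqxx mulr1n subrr mulr0.
rewrite mxtrace_diag => H; rewrite lerBrDr (le_trans _ H)// -big_split /=.
by apply: ler_sum => i _; rewrite !mxE -lerBrDr exp_scalar_coercive.
Qed.

End SpectralForm.

(** * Symmetric and antisymmetric parts; injectivity of exp on S(n) *)

Section SymmetricPart.
Context {R : realType} {n : nat}.
Implicit Types A B X Y : 'M[R]_n.

Definition symp A : 'M[R]_n := 2^-1 *: (A + A^T).
Definition antip A : 'M[R]_n := 2^-1 *: (A - A^T).

Fact symp_is_linear : linear symp.
Proof. by move=> a A B; apply/matrixP => i j; rewrite !mxE; ring. Qed.
HB.instance Definition _ := GRing.isLinear.Build R 'M[R]_n 'M[R]_n _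
  symp symp_is_linear.

Fact antip_is_linear : linear antip.
Proof. by move=> a A B; apply/matrixP => i j; rewrite !mxE; ring. Qed.
HB.instance Definition _ := GRing.isLinear.Build R 'M[R]_n 'M[R]_n _
  antip antip_is_linear.

Fact off_is_linear : linear (@off R n).
Proof.
move=> a A B; apply/matrixP => i j; rewrite !mxE.
by case: (i == j) => //; rewrite mulr0 addr0.
Qed.
HB.instance Definition _ := GRing.isLinear.Build R 'M[R]_n 'M[R]_n _
  (@off R n) off_is_linear.

Lemma symp_sym A : sym (symp A).
Proof. by rewrite /sym /=; apply/matrixP => i j; rewrite !mxE addrC. Qed.

Lemma symp_id A : sym A -> symp A = A.
Proof. by rewrite /sym /symp /= => ->; apply/matrixP => i j; rewrite !mxE; field. Qed.

Lemma antip_eq0 A : sym A -> antip A = 0.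
Proof. by rewrite /sym /antip /= => ->; rewrite subrr scaler0. Qed.

Lemma symp_antip A : symp (antip A) = 0.
Proof. by apply/matrixP => i j; rewrite !mxE; ring. Qed.

Lemma antip_antip A : antip (antip A) = antip A.
Proof. by apply/matrixP => i j; rewrite !mxE; field. Qed.

Lemma sympDantip A : symp A + antip A = A.
Proof. by apply/matrixP => i j; rewrite !mxE; field. Qed.

Lemma symp_norm_le A : `|symp A| <= `|A|.
Proof.
apply: mx_norm_le => // i j; rewrite !mxE normrM ger0_norm ?invr_ge0//.
have H : `|A i j + A j i| <= `|A| + `|A|.
  by rewrite (le_trans (ler_normD _ _))// lerD// mx_norm_ge.
by apply: (le_trans (ler_wpM2l _ H)); [lra|rewrite le_eqVlt; apply/orP; left; apply/eqP; field].
Qed.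

Lemma antip_norm_le A : `|antip A| <= `|A|.
Proof.
apply: mx_norm_le => // i j; rewrite !mxE normrM ger0_norm ?invr_ge0//.
have H : `|A i j - A j i| <= `|A| + `|A|.
  by rewrite (le_trans (ler_normB _ _))// lerD// mx_norm_ge.
by apply: (le_trans (ler_wpM2l _ H)); [lra|rewrite le_eqVlt; apply/orP; left; apply/eqP; field].
Qed.

Lemma antip_off A : antip (off A) = antip A.
Proof.
apply/matrixP => i j; rewrite !mxE [j == i]eq_sym.
by case: eqP => // ->; rewrite !subrr.
Qed.

Lemma symB A B : sym A -> sym B -> sym (A - B).
Proof. by rewrite /sym /= linearB /= => -> ->. Qed.

Lemma symD A B : sym A -> sym B -> sym (A + B).
Proof. by rewrite /sym /= linearD /= => -> ->. Qed.

Lemma symZ (a : R) A : sym A -> sym (a *: A).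
Proof. by rewrite /sym /= linearZ /= => ->. Qed.

Lemma diag_sym A : diag A -> sym A.
Proof. by move=> /diag_mxP[d ->]; rewrite /sym /= tr_diag_mx. Qed.

Lemma mxtrace_mul_norm_le A B : `|\tr (A *m B)| <= n%:R ^+ 2 * `|A| * `|B|.
Proof.
rewrite (le_trans (mxtrace_norm_le _))// expr2 -!mulrA ler_wpM2l// mulrA.
exact: mx_norm_mul.
Qed.

Lemma mxtrace_sqr_ge A : sym A -> `|A| ^+ 2 <= \tr (A *m A).
Proof.
move=> sA; have sE i j : A j i = A i j by have /matrixP/(_ i j) := sA; rewrite mxE.
have A0 : 0 <= \tr (A *m A).
  apply: sumr_ge0 => i _; rewrite mxE; apply: sumr_ge0 => j _.
  by rewrite sE -expr2 sqr_ge0.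
rewrite -ler_sqrt// sqrtr_sqr normr_id; apply: mx_norm_le => [|i j].
  exact: sqrtr_ge0.
rewrite -sqrtr_sqr ler_sqrt// /mxtrace (bigD1 i)//= mxE (bigD1 j)//=.
rewrite (sE i j) -expr2 -addrA lerDl addr_ge0//; apply: sumr_ge0 => k _.
  by rewrite sE -expr2 sqr_ge0.
rewrite mxE; apply: sumr_ge0 => l _.
by rewrite sE -expr2 sqr_ge0.
Qed.

Lemma mxtrace_sqr_le A (r : R) : `|A| <= r -> \tr (A *m A) <= (n%:R * r) ^+ 2.
Proof.
move=> Ar; rewrite (le_trans (ler_norm _))// (le_trans (mxtrace_mul_norm_le _ _))//.
by rewrite exprMn -mulrA ler_wpM2l// expr2 ler_pM.
Qed.

(** Passes from traces to the max norm: |A|^2 <= tr (A^2) <= (n |A|)^2 for symmetric A, whence the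
    constant e^(-n r). *)
Lemma expmx_monotone_norm (r : R) : exists2 c : R, 0 < c & forall X Y,
  sym X -> sym Y -> `|X| <= r -> `|Y| <= r ->
  c * `|X - Y| ^+ 2 <= \tr ((expmx X - expmx Y) *m (X - Y)).
Proof.
exists (expR (- (n%:R * r))); first exact: expR_gt0.
move=> X Y sX sY Xr Yr; have r0 : 0 <= r by exact: le_trans Xr.
apply: (le_trans _ (expmx_strongly_monotone sX sY _ (mxtrace_sqr_le Xr)
  (mxtrace_sqr_le Yr))); last exact: mulr_ge0.
by rewrite ler_wpM2l ?expR_ge0// mxtrace_sqr_ge//; exact: symB.
Qed.

Lemma expmx_monotone X Y : sym X -> sym Y ->
  0 <= \tr ((expmx X - expmx Y) *m (X - Y)).
Proof.
move=> sX sY; have [c c0 H] := expmx_monotone_norm (`|X| + `|Y|).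
by apply: le_trans (H _ _ sX sY _ _); rewrite ?lerDl ?lerDr// mulr_ge0 ?sqr_ge0 ?ltW.
Qed.

(** The trace in the monotonicity estimate is at most n^2 times the product of the two norms;
    dividing by |X - Y| leaves the claim. *)
Lemma expmx_sym_expanding (r : R) : exists2 C : R, 0 <= C & forall X Y,
  sym X -> sym Y -> `|X| <= r -> `|Y| <= r ->
  `|X - Y| <= C * `|expmx X - expmx Y|.
Proof.
have [c c0 H] := expmx_monotone_norm r.
exists (c^-1 * n%:R ^+ 2); first by rewrite mulr_ge0 ?invr_ge0 ?exprn_ge0// ltW.
move=> X Y sX sY Xr Yr.
have [->|XY] := eqVneq (X - Y) 0.
  by rewrite normr0 !mulr_ge0 ?invr_ge0 ?exprn_ge0// ltW.
have t0 : 0 < `|X - Y| by rewrite normr_gt0.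
rewrite -(ler_pM2r t0) -expr2 -!mulrA -ler_pdivrMl ?invr_gt0// invrK !mulrA.
rewrite -[X in X <= _]mulrA -!expr2.
apply: le_trans (H _ _ sX sY Xr Yr) _.
exact: le_trans (ler_norm _) (mxtrace_mul_norm_le _ _).
Qed.

Lemma expmx_sym_inj X Y : sym X -> sym Y -> expmx X = expmx Y -> X = Y.
Proof.
move=> sX sY XY; have [C _ H] := expmx_sym_expanding (`|X| + `|Y|).
have := H _ _ sX sY; rewrite XY subrr normr0 mulr0 lerDl lerDr !normr_ge0.
by move=> /(_ isT isT); rewrite normr_le0 subr_eq0 => /eqP.
Qed.

Lemma sym_logmx A : sym (logmx A).
Proof. exact/set_mem/logmx_sym. Qed.

Lemma logmxK A : spd A -> expmx (logmx A) = A.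
Proof.
move=> /expmx_surj[X sX XA]; rewrite /logmx.
have [] // : [set X | sym X /\ expmx X = A] (xget 0 [set X | sym X /\ expmx X = A]).
by apply: xgetPex; exists X.
Qed.

Lemma expmxK X : sym X -> logmx (expmx X) = X.
Proof.
move=> sX; apply: (expmx_sym_inj (sym_logmx _) sX).
exact/logmxK/expmx_spd.
Qed.

End SymmetricPart.

(** * The symmetric logarithm *)

Section Logarithm.
Context {R : realType} {n : nat}.
Implicit Types A B X Y M : 'M[R]_n.

(* By monotonicity along the segment from X0 to Y, tr ((e^Y - e^X0) (Y - X0))
   is at least linear in |Y - X0|. *)
Lemma expmx_proper X0 : sym X0 -> exists2 e : R, 0 < e & forall Y, sym Y ->
  `|expmx Y - expmx X0| <= e -> `|Y| <= `|X0| + 1.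
Proof.
move=> sX; have [c c0 H] := @expmx_monotone_norm R n (`|X0| + 1).
have n0 : 0 < n%:R ^+ 2 + 1 :> R by rewrite ltr_wpDl// exprn_ge0.
(* For Y outside the ball the estimates give c <= n^2 |e^Y - e^X0|; the 1 added to n^2 makes the
   contradiction strict. *)
exists (c / (n%:R ^+ 2 + 1)) => [|Y sY]; first exact: divr_gt0.
have [//|Yr] := leP `|Y| (`|X0| + 1).
rewrite ler_pdivlMr// => hle; suff : c < c by rewrite ltxx.
apply: lt_le_trans hle.
pose rho := `|Y - X0|.
have rho1 : 1 < rho.
  rewrite ltNge; apply: contraTN Yr => Y1; rewrite -leNgt.
  by rewrite -[Y](subrK X0) (le_trans (ler_normD _ _))// addrC lerD2l.
have rho0 : 0 < rho by exact: lt_trans rho1.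
(* [Z] is the point of the segment at distance 1 from [X0], hence in the ball where [c] is valid;
   monotonicity then carries the bound from [Z] to [Y]. *)
pose Z := X0 + rho^-1 *: (Y - X0).
have sZ : sym Z by exact/symD/symZ/symB.
have ZX : Z - X0 = rho^-1 *: (Y - X0) by rewrite /Z addrAC subrr add0r.
have ZX1 : `|Z - X0| = 1.
  by rewrite ZX normrZ ger0_norm ?invr_ge0 ?ltW// mulVf// gt_eqF.
have Zr : `|Z| <= `|X0| + 1.
  by rewrite -[Z](subrK X0) (le_trans (ler_normD _ _))// ZX1 addrC.
have h1 : c * rho <= \tr ((expmx Z - expmx X0) *m (Y - X0)).
  have := H Z X0 sZ sX Zr; rewrite lerDl => /(_ ler01).
  rewrite ZX1 expr1n mulr1 ZX -scalemxAr linearZ /= mulrC.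
  by rewrite ler_pdivlMr.
have h2 : 0 <= \tr ((expmx Y - expmx Z) *m (Y - X0)).
  have := expmx_monotone sY sZ.
  have -> : Y - Z = (1 - rho^-1) *: (Y - X0).
    by rewrite scalerBl scale1r -ZX opprB addrA subrK.
  rewrite -scalemxAr linearZ /= pmulr_rge0// subr_gt0 invf_lt1//.
have h3 : c * rho <= \tr ((expmx Y - expmx X0) *m (Y - X0)).
  apply: (le_trans h1); rewrite -subr_ge0 -linearB -mulmxBl /=.
  by rewrite opprB addrA subrK.
have h4 := le_trans h3 (le_trans (ler_norm _) (mxtrace_mul_norm_le _ _)).
rewrite -/rho ler_pM2r// in h4.
apply: (le_lt_trans h4).
have Yn : 0 < `|expmx Y - expmx X0|.
  rewrite normr_gt0; apply: contraTneq h4 => ->.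
  by rewrite normr0 mulr0 leNgt c0.
by rewrite mulrC ltr_pM2l// ltrDl.
Qed.

Lemma spd_perturb A : spd A -> exists2 e : R, 0 < e & forall B, sym B ->
  `|B - A| <= e -> spd B.
Proof.
move=> /[dup] [[/sym_spectral_form[P [d [PP ->]]] _]].
move=> /(spd_spectral_form d PP) d0; have PP' := mulmx1C PP.
(* [s^-1] lies below every eigenvalue, and the summand 1 keeps [s] positive even when n = 0. *)
pose s : R := \sum_i (d 0 i)^-1 + 1.
have s0 : 0 < s.
  by rewrite ltr_wpDl// sumr_ge0// => i _; rewrite invr_ge0 ltW.
have sd i : s^-1 <= d 0 i.
  rewrite -[leRHS]invrK lef_pV2 ?posrE ?invr_gt0//.
  rewrite /s (bigD1 i)//= -addrA lerDl addr_ge0// sumr_ge0// => j _.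
  by rewrite invr_ge0 ltW.
have n0 : 0 < n%:R + 1 :> R by rewrite ltr_wpDl.
exists (s^-1 / (n%:R + 1)); first by rewrite divr_gt0// invr_gt0.
move=> B sB BA; split=> // x x0.
set A0 := spectral_form P d in BA *.
pose q := \sum_i x i 0 ^+ 2.
have q0 : 0 < q.
  have /cV0Pn[i xi] := x0.
  rewrite /q (bigD1 i)//= ltr_pwDl ?exprn_even_gt0//.
  by apply: sumr_ge0 => j _; exact: sqr_ge0.
have h1 : s^-1 * q <= (x^T *m A0 *m x) 0 0.
  rewrite /A0 quad_spectral_form.
  have -> : q = \sum_i (P *m x) i 0 ^+ 2.
    have -> : q = (x^T *m x) 0 0.
      by rewrite mxE; apply: eq_bigr => i _; rewrite mxE expr2.
    have -> : x^T *m x = (P *m x)^T *m (P *m x).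
      by rewrite trmx_mul mulmxA -[_ *m P^T *m P]mulmxA PP' mulmx1.
    move: (P *m x) => y.
    by rewrite mxE; apply: eq_bigr => i _; rewrite mxE expr2.
  rewrite mulr_sumr; apply: ler_sum => i _.
  by rewrite ler_wpM2r ?sqr_ge0.
(* From |x_i x_j| <= (x_i^2 + x_j^2) / 2, summed over all i and j. *)
have h2 : `|(x^T *m (B - A0) *m x) 0 0| <= `|B - A0| * (n%:R * q).
  rewrite mxE (le_trans (ler_norm_sum _ _ _))//.
  apply: (@le_trans _ _ (\sum_j \sum_i `|B - A0| * ((x i 0 ^+ 2 + x j 0 ^+ 2) / 2))).
    apply: ler_sum => j _; rewrite mxE mulr_suml.
    rewrite (le_trans (ler_norm_sum _ _ _))//; apply: ler_sum => i _.
    rewrite [x^T _ _]mxE mulrAC mulrC normrM ler_pM// ?mx_norm_ge//.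
    rewrite ler_norml; apply/andP; split.
      rewrite -subr_ge0 opprK [X in 0 <= X](_ : _ = (x i 0 + x j 0) ^+ 2 / 2).
        by rewrite divr_ge0// sqr_ge0.
      by field.
    rewrite -subr_ge0 [X in 0 <= X](_ : _ = (x i 0 - x j 0) ^+ 2 / 2).
      by rewrite divr_ge0// sqr_ge0.
    by field.
  under eq_bigr do rewrite -mulr_sumr -mulr_suml big_split /=.
  rewrite -mulr_sumr ler_wpM2l// -mulr_suml big_split /= -/q.
  rewrite sumr_const card_ord.
  under eq_bigr do rewrite sumr_const card_ord.
  by rewrite sumrMnl -/q -mulr_natl le_eqVlt; apply/orP; left; apply/eqP; field.
have -> : x^T *m B *m x = x^T *m A0 *m x + x^T *m (B - A0) *m x.
  by rewrite -mulmxDl -mulmxDr addrC subrK.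
rewrite mxE; have h3 : `|B - A0| * (n%:R * q) < s^-1 * q.
  rewrite mulrA ltr_pM2r//.
  apply: (@le_lt_trans _ _ (s^-1 / (n%:R + 1) * n%:R)); first by rewrite ler_wpM2r.
  by rewrite -mulrA gtr_pMr ?invr_gt0// mulrC ltr_pdivrMr// mul1r ltrDl.
have := le_lt_trans h2 h3; rewrite ltr_norml => /andP[+ _].
by move: h1; lra.
Qed.

(** For n >= 2, S^+(n) has empty interior among all matrices; this set thickens it in the
    antisymmetric directions and is open. *)
Definition symp_spd : set 'M[R]_n := [set M | spd (symp M)].

Lemma open_symp_spd : open symp_spd.
Proof.
rewrite openE => M /= sM; have [e e0 H] := spd_perturb sM.
apply/nbhs_ballP; exists e => //= N.
rewrite -ball_normE /= => MN; apply: H; first exact: symp_sym.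
by rewrite -linearB (le_trans (symp_norm_le _))// distrC ltW.
Qed.

Lemma smooth_expmx_symp : smooth_on setT (fun X => expmx (symp X)).
Proof.
apply: (smooth_on_comp (O := setT)) => //; try exact: openT.
  exact: expmx_smooth.
exact/smooth_on_linear/mx_linear_continuous.
Qed.

(* Acting as the identity on antisymmetric parts makes exp injective on all
   matrices, with inverse defined on an open set. *)
Let exp_ext X : 'M[R]_n := expmx (symp X) + antip X.
Let log_ext M : 'M[R]_n := logmx (symp M) + antip M.

Let exp_ext_expanding : locally_expanding exp_ext.
Proof.
move=> r; have [C C0 H] := @expmx_sym_expanding R n r; exists (C + 1) => X Y Xr Yr.
have sE Z : symp (exp_ext Z) = expmx (symp Z).
  rewrite linearD /= symp_antip addr0 symp_id//.
  by have [] := expmx_spd (symp_sym Z).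
have aE Z : antip (exp_ext Z) = antip Z.
  rewrite linearD /= antip_antip antip_eq0 ?add0r//.
  by have [] := expmx_spd (symp_sym Z).
rewrite -[X - Y]sympDantip (le_trans (ler_normD _ _))// mulrDl mul1r lerD//.
  rewrite linearB (le_trans (H _ _ (symp_sym _) (symp_sym _) _ _))//.
  - exact: le_trans (symp_norm_le _) _.
  - exact: le_trans (symp_norm_le _) _.
  - by rewrite ler_wpM2l// -!sE -linearB symp_norm_le.
by rewrite linearB /= -(aE X) -(aE Y) -linearB antip_norm_le.
Qed.

(** [smooth_on_inverse] for [exp_ext], with the identity as right-hand side and local boundedness
    from [expmx_proper]; [symp] then discards the antisymmetric part of the inverse. *)
Lemma smooth_on_logmx_symp : smooth_on symp_spd (fun M => logmx (symp M)).
Proof.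
have oS := open_symp_spd.
have cA : continuous (@antip R n) by exact: mx_linear_continuous.
have cS : continuous (@symp R n) by exact: mx_linear_continuous.
have s_exp : smooth_on setT exp_ext.
  apply: smooth_onD; [exact: openT|exact: smooth_expmx_symp|].
  exact: smooth_on_linear.
have s_id : smooth_on symp_spd (@idfun 'M[R]_n).
  by apply: smooth_on_linear => x; exact: cvg_id.
have log_exp M : symp_spd M -> exp_ext (log_ext M) = idfun M.
  move=> sM; rewrite /exp_ext /log_ext !linearD /= symp_antip addr0 antip_antip.
  rewrite (symp_id (sym_logmx _)) (antip_eq0 (sym_logmx _)).
  by rewrite add0r logmxK// sympDantip.
have log_bounded M : symp_spd M ->
    exists r : R, \forall N \near M, `|log_ext N| <= r.
  move=> sM; have [e e0 H] := expmx_proper (sym_logmx (symp M)).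
  exists (`|logmx (symp M)| + 1 + (`|M| + 1)).
  have nU : \forall N \near M, symp_spd N by exact: open_nbhs_nbhs.
  near=> N.
  have sN : symp_spd N by near: N.
  have NM1 : `|M - N| <= 1 by near: N; apply: cvgr_dist_le => //; exact: cvg_id.
  have NMe : `|M - N| <= e by near: N; apply: cvgr_dist_le => //; exact: cvg_id.
  rewrite (le_trans (ler_normD _ _))// lerD//.
    apply: H; first exact: sym_logmx.
    by rewrite !logmxK// -linearB (le_trans (symp_norm_le _))// distrC.
  rewrite (le_trans (antip_norm_le _))// -[N](subrK M).
  by rewrite (le_trans (ler_normD _ _))// addrC lerD2l distrC.
have := smooth_on_inverse oS s_exp s_id log_exp log_bounded exp_ext_expanding.
move=> /(smooth_on_linear_comp oS cS); apply: smooth_on_eq => // M _ /=.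
by rewrite linearD /= symp_antip addr0 symp_id//; exact: sym_logmx.
Unshelve. all: by end_near. Qed.

End Logarithm.

(** * The correlation diagonal *)

Section CorrelationDiagonal.
Context {R : realType} {n : nat}.
Implicit Types A B S X Y D : 'M[R]_n.

Lemma mx_subE A B i j : (A - B) i j = A i j - B i j.
Proof. by rewrite !mxE. Qed.

Definition diag_part A : 'M[R]_n := diag_mx (\row_i A i i).

Fact diag_part_is_linear : linear diag_part.
Proof.
by move=> a A B; rewrite /diag_part -linearP; congr diag_mx; apply/rowP => i; rewrite !mxE.
Qed.
HB.instance Definition _ := GRing.isLinear.Build R 'M[R]_n 'M[R]_n _
  diag_part diag_part_is_linear.

Lemma offDdiag_part A : off A + diag_part A = A.
Proof.
apply/matrixP => i j; rewrite !mxE.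
by case: eqP => [->|_]; rewrite ?mulr1n ?mulr0n ?add0r ?addr0.
Qed.

Lemma off_diag D : diag D -> off D = 0.
Proof.
move=> /is_diag_mxP dD; apply/matrixP => i j; rewrite !mxE.
by case: eqP => // /eqP ij; rewrite dD.
Qed.

Lemma off_eq0_diag A : off A = 0 -> diag A.
Proof.
by move=> A0; rewrite /diag /= -(offDdiag_part A) A0 add0r /diag_part diag_mx_is_diag.
Qed.

Lemma mxtrace_mul_delta A i : \tr (A *m diag_mx (delta_mx 0 i)) = A i i.
Proof.
rewrite mul_mx_diag /mxtrace (bigD1 i)//= big1 => [|j ji].
  by rewrite !mxE !eqxx mulr1 addr0.
by rewrite !mxE (negbTE ji) mulr0.
Qed.

Lemma mxtrace_mul_diag_unit A D : diag D -> (forall i, A i i = 1) ->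
  \tr (A *m D) = \tr D.
Proof.
move=> /diag_mxP[d ->] A1; rewrite mul_mx_diag; apply: eq_bigr => i _.
by rewrite !mxE A1 mul1r eqxx.
Qed.

(** [phi] is nonnegative to the right of 0 and nonpositive to the left. This serves as the
    first-order condition at a minimum. *)
Lemma eq0_of_mul_ge0 (phi : R -> R) : {for 0, continuous phi} ->
  (forall t, 0 <= t * phi t) -> phi 0 = 0.
Proof.
move=> cphi phi0; apply/eqP; rewrite eq_le !leNgt; apply/andP; split; apply/negP.
move=> p0.
  have /nbhs_ballP[e /= e0 H] : \forall t \near (0 : R), 0 < phi t by exact: (cvgr_gt _ cphi).
  have := phi0 (- (e / 2)); rewrite nmulr_rge0 ?oppr_lt0 ?divr_gt0// leNgt H//.
  by rewrite /ball /= sub0r opprK ger0_norm ?divr_ge0 ?ltW// ltr_pdivrMr// ltr_pMr// ltr1n.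
move=> p0.
have /nbhs_ballP[e /= e0 H] : \forall t \near (0 : R), phi t < 0 by exact: (cvgr_lt _ cphi).
have := phi0 (e / 2); rewrite pmulr_rge0 ?divr_gt0// leNgt H//.
by rewrite /ball /= sub0r normrN ger0_norm ?divr_ge0 ?ltW// ltr_pdivrMr// ltr_pMr// ltr1n.
Qed.

Lemma affine_diag_smooth S : smooth_on setT (fun d : 'rV[R]_n => expmx (S + diag_mx d)).
Proof.
apply: (smooth_on_comp (O := setT) (f := fun d => S + diag_mx d)) => //; try exact: openT.
  exact: expmx_smooth.
apply: smooth_onD; [exact: openT|exact: smooth_on_cst|].
exact/smooth_on_linear/mx_linear_continuous.
Qed.

Lemma cor_diag_exists S : sym S ->
  exists D, diag D /\ cor (expmx (S + D)).
Proof.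
move=> sS; pose X (d : 'rV[R]_n) := S + diag_mx d.
have sX d : sym (X d) by apply: symD => //; rewrite /sym /= tr_diag_mx.
pose G d : R := \tr (expmx (X d)) - \tr (X d).
have cG : continuous G.
  have ctr M : {for M, continuous (@mxtrace R n)}.
    apply: (@iter_diff_sum _ _ _ 0 setT) => //; first exact: openT.
    by move=> i _; exact: iter_diff_coord.
  have cX : smooth_on setT X.
    apply: smooth_onD; [exact: openT|exact: smooth_on_cst|].
    exact/smooth_on_linear/mx_linear_continuous.
  move=> d.
  have c1 : {for d, continuous (fun e => \tr (expmx (X e)))}.
    apply: (@continuous_comp _ _ _ (fun e => expmx (X e))); last exact: ctr.
    exact: (smooth_on_continuous (affine_diag_smooth S)).
  have c2 : {for d, continuous (fun e => \tr (X e))}.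
    apply: (@continuous_comp _ _ _ X); last exact: ctr.
    exact: (smooth_on_continuous cX).
  exact: (cvgB c1 c2).
(* By coercivity, G d <= G 0 forces |d_i + S_ii| <= G 0. The sublevel set thus lies in a compact
   box, and a minimum over the box is global because the box contains 0. *)
pose box := [set d : 'rV[R]_n | forall i,
  `[- S i i - G 0, - S i i + G 0]%classic (d ord0 i)].
have boxP d : G d <= G 0 -> box d.
  move=> dG i /=; rewrite in_itv /= -ler_distl opprK.
  apply: le_trans dG; apply: le_trans (mxtrace_expmx_coercive (sX d)).
  have -> : d ord0 i + S i i = X d i i by rewrite !mxE eqxx mulr1n addrC.
  rewrite (bigD1 i)//= lerDl.
  by apply: sumr_ge0.
have box0 : box !=set0 by exists 0; exact: boxP.
have cbox : compact box by apply: (@rV_compact R n (fun i => `[- S i i - G 0, - S i i + G 0]%classic)) => i;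
  exact: segment_compact.
have [c _ cmin] := EVT_min_rV box0 cbox (continuous_subspaceT cG).
have Gmin d : G c <= G d.
  have [/boxP bd|/ltW] := leP (G d) (G 0); first by apply: cmin; exact/mem_set.
  by apply: le_trans; apply: cmin; exact/mem_set/boxP.
exists (diag_mx c); split; first exact: diag_mx_is_diag.
split=> [|i]; first exact/expmx_spd/sX.
pose Z t := X (c + t *: delta_mx 0 i).
have ZE t : Z t = X c + t *: diag_mx (delta_mx 0 i).
  by rewrite /Z /X linearD linearZ /= addrA.
have Z0 : Z 0 = X c by rewrite ZE scale0r addr0.
apply/eqP; rewrite -subr_eq0 -/(X c) -Z0; apply/eqP.
apply: (eq0_of_mul_ge0 (phi := fun t => expmx (Z t) i i - 1)) => [|t].
  have c1 : {for (0 : R), continuous (fun t : R => c + t *: delta_mx 0 i)}.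
    by apply: cvgD; [exact: cvg_cst|exact: scalel_continuous].
  have c2 : {for (0 : R), continuous (fun t : R => expmx (Z t))}.
    apply: (continuous_comp c1 (g := fun d => expmx (S + diag_mx d))).
    exact: (smooth_on_continuous (affine_diag_smooth S)).
  have c3 : {for (0 : R), continuous (fun t : R => expmx (Z t) i i)}.
    apply: (continuous_comp c2 (g := fun M : 'M[R]_n => M i i)).
    exact: coord_continuous.
  by apply: cvgB; [exact: c3|exact: cvg_cst].
(* Convexity at [Z t] and minimality at [c] together give t <= t (e^(Z t))_ii for [t] of either
   sign, in place of a derivative of [G]. *)
have h1 := mxtrace_expmx_convex (sX (c + t *: delta_mx 0 i)) (sX c).
have h2 := Gmin (c + t *: delta_mx 0 i); rewrite /G -!/(Z t) in h1 h2.
have e1 : X c - Z t = - t *: diag_mx (delta_mx 0 i).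
  by rewrite ZE opprD addNKr scaleNr.
have e2 : \tr (Z t) = \tr (X c) + t.
  rewrite ZE linearD linearZ /= -[diag_mx _]mul1mx mxtrace_mul_delta.
  by rewrite mxE eqxx mulr1.
rewrite e1 -scalemxAr linearZ /= mxtrace_mul_delta in h1.
rewrite e2 in h2; rewrite mulrBr mulr1; move: h1 h2; lra.
Qed.

Lemma cor_diagP S : sym S -> diag (cor_diag S) /\ cor (expmx (S + cor_diag S)).
Proof.
move=> /cor_diag_exists[D HD]; rewrite /cor_diag.
exact: (@xgetPex _ 0 [set X | diag X /\ cor (expmx (S + X))] (ex_intro _ D HD)).
Qed.

(** Convexity at S + D, where the unit diagonal gives tr (e^(S + D) D) = tr D, shows that tr e^X -
    tr X is no larger at S + D than at S; coercivity then bounds the diagonal. This is the source of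
    the local boundedness of the map D. *)
Lemma cor_diag_bound S D : sym S -> diag D -> cor (expmx (S + D)) ->
  \sum_i `|(S + D) i i| <= \tr (expmx S) - \tr S.
Proof.
move=> sS dD [_ e1]; have sX := symD sS (diag_sym dD).
apply: le_trans (mxtrace_expmx_coercive sX) _.
have := mxtrace_expmx_convex sX sS.
rewrite opprD addNKr mulmxN linearN /= mxtrace_mul_diag_unit// linearD /=.
lra.
Qed.

(* Its inverse on symmetric matrices recovers S + D(S) from off S + I. *)
Definition cor_ext X : 'M[R]_n := off X + diag_part (expmx (symp X)).

Lemma cor_ext_off X i j : i != j -> cor_ext X i j = X i j.
Proof. by move=> ij; rewrite !mxE (negbTE ij) mulr0n addr0. Qed.

Lemma cor_ext_diag X i : cor_ext X i i = expmx (symp X) i i.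
Proof. by rewrite !mxE eqxx mulr1n add0r. Qed.

(** Let A and B be the symmetric parts. In each product of entries in tr ((e^A - e^B) (A - B)), one
    factor is bounded by [u]: the exponential one on the diagonal, the one from A - B off it. The
    other factor is at most |A - B|, or L |A - B| by the Lipschitz bound on exp. Comparison with c
    |A - B|^2 bounds |A - B|, and the antisymmetric part is read off the off-diagonal entries. *)
Lemma cor_ext_expanding : locally_expanding cor_ext.
Proof.
move=> r; have [c c0 H] := @expmx_monotone_norm R n r.
pose L := expR ((n + n)%:R * (`|r| + 1)).
have L0 : 0 < L by exact: expR_gt0.
pose K := c^-1 * (n%:R ^+ 2 * (1 + L)).
have K0 : 0 <= K by rewrite !mulr_ge0 ?invr_ge0 ?exprn_ge0 ?addr_ge0// ltW.
exists (K + 1) => X Y Xr Yr.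
set u := `|cor_ext X - cor_ext Y|.
have u_off i j : i != j -> `|(X - Y) i j| <= u.
  move=> ij.
  have -> : (X - Y) i j = (cor_ext X - cor_ext Y) i j.
    transitivity (X i j - Y i j); first exact: mx_subE.
    transitivity (cor_ext X i j - cor_ext Y i j); last exact/esym/mx_subE.
    by congr (_ - _); exact/esym/cor_ext_off.
  exact: mx_norm_ge.
set A := symp X; set B := symp Y.
have [sA sB] : sym A /\ sym B by split; exact: symp_sym.
have Ar : `|A| <= r by exact: le_trans (symp_norm_le _) Xr.
have Br : `|B| <= r by exact: le_trans (symp_norm_le _) Yr.
have u0 : 0 <= u by exact: normr_ge0.
have hL : `|expmx A - expmx B| <= L * `|A - B|.
  apply: expmx_lipschitz; first by rewrite lerDr.
    by rewrite (le_trans Ar)// (le_trans (ler_norm _))// lerDl.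
  by rewrite (le_trans Br)// (le_trans (ler_norm _))// lerDl.
have h1 : `|A - B| <= K * u.
  have [->|AB] := eqVneq (A - B) 0; first by rewrite normr0 mulr_ge0.
  have t0 : 0 < `|A - B| by rewrite normr_gt0.
  rewrite -(ler_pM2r t0) /K -!mulrA -ler_pdivrMl ?invr_gt0// invrK.
  rewrite -expr2; apply: le_trans (H _ _ sA sB Ar Br) _.
  apply: le_trans (ler_norm _) _.
  apply: (@le_trans _ _ (\sum_(i < n) \sum_(j < n) (1 + L) * (u * `|A - B|))).
    apply: le_trans (ler_norm_sum _ _ _) _; apply: ler_sum => i _.
    rewrite mxE; apply: le_trans (ler_norm_sum _ _ _) _; apply: ler_sum => j _.
    rewrite normrM mulrDl mul1r; have [<-|ij] := eqVneq i j.
      rewrite -[leLHS]addr0 lerD//; last by rewrite !mulr_ge0// ltW.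
      rewrite ler_pM// ?mx_norm_ge//.
      have -> : (expmx A - expmx B) i i = (cor_ext X - cor_ext Y) i i.
        transitivity (expmx A i i - expmx B i i); first exact: mx_subE.
        transitivity (cor_ext X i i - cor_ext Y i i); last exact/esym/mx_subE.
        by congr (_ - _); exact/esym/cor_ext_diag.
      exact: mx_norm_ge.
    rewrite -[leLHS]add0r lerD//; first by rewrite mulr_ge0.
    rewrite mulrA [L * u]mulrC -mulrA mulrC; apply: ler_pM => //.
      have -> : A - B = symp (X - Y) by rewrite linearB.
      rewrite !mxE normrM ger0_norm ?invr_ge0//.
      have := u_off _ _ ij; have : j != i by rewrite eq_sym.
      move=> /u_off; rewrite !mxE => e1 e2.
      have := ler_normD (X j i - Y j i) (X i j - Y i j); lra.
    exact: le_trans (mx_norm_ge _ _ _) hL.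
  rewrite !sumr_const card_ord -mulrnA mulnn -[leLHS]mulr_natl natrX expr2 -mulrA.
  exact: lexx.
rewrite -[X - Y]sympDantip (le_trans (ler_normD _ _))// mulrDl mul1r lerD//.
  by rewrite linearB.
rewrite -antip_off (le_trans (antip_norm_le _))//; apply: mx_norm_le => // i j.
by rewrite mxE; case: eqP => [_|/eqP/u_off//]; rewrite normr0.
Qed.

(** Both S + D and S + [cor_diag S] are sent to off S + I by [cor_ext], which is injective because
    it is expanding. *)
Lemma cor_diag_uniq S D : sym S -> diag D -> cor (expmx (S + D)) ->
  cor_diag S = D.
Proof.
move=> sS dD [_ c1]; have [dD' [_ c1']] := cor_diagP sS.
apply: (addrI S); set X := S + _; set Y := S + _.
have [C H] := cor_ext_expanding (`|X| + `|Y|).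
have := H X Y; rewrite lerDl lerDr !normr_ge0 => /(_ isT isT).
suff -> : cor_ext X = cor_ext Y.
  by rewrite subrr normr0 mulr0 normr_le0 subr_eq0 => /eqP.
have [sX sY] : sym X /\ sym Y by split; exact/symD/diag_sym.
rewrite /cor_ext (symp_id sX) (symp_id sY).
rewrite !linearD /= (off_diag dD) (off_diag dD') /diag_part; congr (_ + diag_mx _).
by apply/rowP => i; rewrite !mxE c1 c1'.
Qed.

Lemma smooth_on_cor_diag_symp : smooth_on setT (fun S => cor_diag (symp S)).
Proof.
have oT : open [set: 'M[R]_n] by exact: openT.
have linT (L : {linear 'M[R]_n -> 'M[R]_n}) : smooth_on setT L.
  exact/smooth_on_linear/mx_linear_continuous.
have s_off : smooth_on setT (@off R n).
  by apply: smooth_on_linear; exact: mx_linear_continuous.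
have s_cor : smooth_on setT cor_ext.
  have s2 := smooth_on_linear_comp oT (@mx_linear_continuous _ _ _ _ diag_part)
    (@smooth_expmx_symp R n).
  exact: (smooth_onD oT s_off s2).
(* [cor_ext (g S)] keeps the off-diagonal entries of S, and the unit diagonal of the correlation
   matrix contributes I: this is the equation to which [smooth_on_inverse] applies. *)
pose g S := S + cor_diag (symp S); pose h S : 'M[R]_n := off S + 1%:M.
have sh : smooth_on setT h.
  by apply: (smooth_onD oT s_off); exact: smooth_on_cst.
have gh S : setT S -> cor_ext (g S) = h S.
  move=> _; have [dD [_ c1]] := cor_diagP (symp_sym S).
  rewrite /cor_ext /g !linearD /= (off_diag dD) addr0.
  rewrite (symp_id (diag_sym dD)); congr (_ + _).
  by apply/matrixP => i j; rewrite !mxE c1.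
have g_bounded S : setT S -> exists r : R, \forall Z \near S, `|g Z| <= r.
  move=> _; pose b := `|S| + 1.
  (* [b] bounds [Z] near S, hence the off-diagonal entries of [g Z]; the other terms bound tr
     e^(symp Z) - tr (symp Z), hence the diagonal entries through [cor_diag_bound]. *)
  exists (b + (n%:R * expR (n%:R * b) + n%:R * b)).
  have Zb : \forall Z \near S, `|Z| <= b.
    near=> Z; rewrite -[Z](subrK S) (le_trans (ler_normD _ _))// addrC lerD2l distrC.
    by near: Z; apply: cvgr_dist_le => //; exact: cvg_id.
  apply: filterS Zb => Z Zb; have [dD cD] := cor_diagP (symp_sym Z).
  have b0 : 0 <= b by exact: addr_ge0.
  have sb : `|symp Z| <= b by exact: le_trans (symp_norm_le _) Zb.
  apply: mx_norm_le => [|i j].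
    by rewrite !addr_ge0 ?mulr_ge0 ?expR_ge0.
  have [<-|ij] := eqVneq i j.
    have -> : g Z i i = (symp Z + cor_diag (symp Z)) i i.
      by rewrite !mxE; congr (_ + _); field.
    apply: (@le_trans _ _ (n%:R * expR (n%:R * b) + n%:R * b)); last by rewrite lerDr.
    apply: (@le_trans _ _ (\sum_i `|(symp Z + cor_diag (symp Z)) i i|)).
      by rewrite (bigD1 i)//= lerDl sumr_ge0.
    apply: le_trans (cor_diag_bound (symp_sym Z) dD cD) _.
    rewrite (le_trans (ler_norm _))// (le_trans (ler_normB _ _))// lerD//.
      rewrite (le_trans (mxtrace_norm_le _))// ler_wpM2l//.
      by rewrite (le_trans (expmx_norm_le _))// ler_expR ler_wpM2l.
    by rewrite (le_trans (mxtrace_norm_le _))// ler_wpM2l.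
  rewrite /g mxE; have /is_diag_mxP -> // := dD; rewrite addr0.
  rewrite (le_trans (mx_norm_ge _ _ _))// (le_trans Zb)// lerDl.
  by rewrite addr_ge0 ?mulr_ge0 ?expR_ge0.
have sg := smooth_on_inverse oT s_cor sh gh g_bounded cor_ext_expanding.
have := smooth_onD oT sg (linT (@GRing.opp 'M[R]_n)).
by apply: smooth_on_eq => // S _ /=; rewrite /g addrAC subrr add0r.
Unshelve. all: by end_near. Qed.

End CorrelationDiagonal.

(** * Smooth spaces *)

Section SmoothSpaceTheory.
Context {R : realType}.
Implicit Types M N P : smooth_space R.

Lemma smooth_map_comp M N P (f : M -> N) (g : N -> P) :
  smooth_map f -> smooth_map g -> smooth_map (g \o f).
Proof. by move=> sf sg phi /sg/sf. Qed.

Lemma smooth_curve_comp M N (f : M -> N) (c : R -> M) :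
  smooth_map f -> smooth_curve c -> smooth_curve (f \o c).
Proof. by move=> sf sc phi /sf/sc. Qed.

Lemma push_velocity M N (f : M -> N) (c : R -> M) :
  smooth_map f -> push f (velocity c) = velocity (f \o c).
Proof.
move=> sf; apply/funext => phi; rewrite /push /velocity.
case: asboolP => // sphi; case: asboolP => // nsphi.
by exfalso; apply: nsphi; exact: sf.
Qed.

Lemma tangent_push M N (f : M -> N) p v :
  smooth_map f -> tangent p v -> tangent (f p) (push f v).
Proof.
move=> sf [c [sc <- ->]]; exists (f \o c).
by split=> //; [exact: smooth_curve_comp|exact: push_velocity].
Qed.

Lemma push_comp M N P (f : M -> N) (g : N -> P) (v : functional M) :
  smooth_map g -> push g (push f v) = push (g \o f) v.
Proof.
move=> sg; apply/funext => phi; rewrite /push.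
case: asboolP => // sphi; case: asboolP => // nsphi.
by exfalso; apply: nsphi; exact: sg.
Qed.

(** Tangency matters: [push] returns 0 on functions that are not smooth, and an arbitrary functional
    need not vanish there. *)
Lemma push_id M p (v : functional M) : tangent p v -> push id v = v.
Proof.
move=> [c [_ _ ->]]; apply/funext => phi; rewrite /push /velocity.
by case: asboolP.
Qed.

Lemma push0 M N (f : M -> N) : push f (fun=> 0 : R) = (fun=> 0).
Proof. by apply/funext => phi; rewrite /push; case: asboolP. Qed.

Lemma push_linear M N (f : M -> N) (a : R) (u v : functional M) :
  push f (fun phi => a * u phi + v phi) =
  (fun phi => a * push f u phi + push f v phi).
Proof.
apply/funext => phi; rewrite /push.
by case: asboolP => // _; rewrite mulr0 addr0.
Qed.

Lemma diffeomorphism_comp M N P (f : M -> N) (g : N -> P) :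
  diffeomorphism f -> diffeomorphism g -> diffeomorphism (g \o f).
Proof.
move=> [sf [f' [sf' fK f'K]]] [sg [g' [sg' gK g'K]]].
split; first exact: smooth_map_comp.
exists (f' \o g'); split; first exact: smooth_map_comp.
- exact: can_comp.
- exact: can_comp.
Qed.

(** Positivity holds because [push f'] undoes [push f] on tangent vectors; for smoothness, fields on
    M are transported to N by pushing their values at [f' q]. *)
Lemma pullback_riemannian M N (f : M -> N) (h : metric N) :
  diffeomorphism f -> riemannian_metric h -> riemannian_metric (pullback f h).
Proof.
move=> [sf [f' [sf' fK f'K]]] [hl hs hp hsm]; split.
- move=> p a u v w tu tv tw; rewrite /pullback push_linear.
  by apply: hl; exact: tangent_push.
- by move=> p u v tu tv; apply: hs; exact: tangent_push.
- move=> p u tu u0; apply: hp; first exact: tangent_push.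
  move=> fu0; apply: u0; rewrite -(push_id tu).
  have -> : id = f' \o f by apply/funext => x /=; rewrite fK.
  by rewrite -push_comp// fu0 push0.
- move=> X Y [tX sX] [tY sY].
  have sfield Z : (forall p, tangent p (Z p)) ->
      (forall phi : M -> R, smooth_fun phi -> smooth_fun (fun p => Z p phi)) ->
      smooth_field (fun q => push f (Z (f' q))).
    move=> tZ sZ; split=> [q|phi sphi].
      by rewrite -{1}[q]f'K; apply: tangent_push.
    have := sf' _ (sZ _ (sf _ sphi)).
    congr smooth_fun; apply/funext => q; rewrite /push /=.
    by case: asboolP.
  have := sf _ (hsm _ _ (sfield X tX sX) (sfield Y tY sY)).
  congr smooth_fun; apply/funext => p /=.
  by rewrite /pullback fK.
Qed.

End SmoothSpaceTheory.

(** * Submanifolds of matrix spaces and the Frobenius metric *)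

Section SubsetSpace.
Context {R : realType}.

Section FunctionAlgebra.
Context {V : normedModType R} (A : set V).
Implicit Types phi psi : subset_space A -> R.

Lemma smooth_fun_cst (a : R) : @smooth_fun R (subset_space A) (fun=> a).
Proof.
move=> p; exists setT, (fun=> a); split => //; first exact: openT.
exact: smooth_on_cst.
Qed.

Lemma smooth_funD phi psi : smooth_fun phi -> smooth_fun psi ->
  smooth_fun (phi \+ psi).
Proof.
move=> sphi spsi p; have [U [F [oU Up sF FE]]] := sphi p.
have [U' [F' [oU' Up' sF' FE']]] := spsi p.
exists (U `&` U'), (F \+ F'); split => //; first exact: openI.
  move=> k; apply: iter_diffD; first exact: openI.
    by apply: iter_diff_sub (sF k) => x [].
  by apply: iter_diff_sub (sF' k) => x [].
by move=> q [Uq Uq'] /=; rewrite FE// FE'.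
Qed.

Lemma smooth_funM phi psi : smooth_fun phi -> smooth_fun psi ->
  smooth_fun (phi \* psi).
Proof.
move=> sphi spsi p; have [U [F [oU Up sF FE]]] := sphi p.
have [U' [F' [oU' Up' sF' FE']]] := spsi p.
exists (U `&` U'), (F \* F'); split => //; first exact: openI.
  move=> k; apply: iter_diffM; first exact: openI.
    by apply: iter_diff_sub (sF k) => x [].
  by apply: iter_diff_sub (sF' k) => x [].
by move=> q [Uq Uq'] /=; rewrite FE// FE'.
Qed.

Lemma smooth_fun_sum (I : Type) (r : seq I) (F : I -> subset_space A -> R) :
  (forall i, smooth_fun (F i)) ->
  @smooth_fun R (subset_space A) (fun p => \sum_(i <- r) F i p).
Proof.
move=> sF; elim: r => [|i r IH].
  have := smooth_fun_cst 0; congr smooth_fun.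
  by apply/funext => p; rewrite big_nil.
have := smooth_funD (sF i) IH; congr smooth_fun.
by apply/funext => p; rewrite big_cons.
Qed.

End FunctionAlgebra.

Section MatrixSubset.
Context {m n : nat}.
Implicit Types B : set 'M[R]_(m, n).

Lemma subset_smooth_map (V : normedModType R) (A : set V) B
    (f : subset_space A -> subset_space B) :
  (forall p : subset_space A, exists (U : set V) (F : V -> 'M[R]_(m, n)),
    [/\ open U, U (val (p : A)), smooth_on U F
      & forall q : A, U (val q) -> F (val q) = val (f q : B)]) ->
  smooth_map f.
Proof.
move=> Hf phi sphi p; have [U [F [oU Up sF FE]]] := Hf p.
have [U' [F' [oU' Up' sF' FE']]] := sphi (f p).
have oUU : open (U `&` F @^-1` U').
  rewrite openE => x [Ux Fx]; apply: filterI; first exact: open_nbhs_nbhs.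
  apply: (smooth_on_continuous sF Ux).
  exact: open_nbhs_nbhs.
exists (U `&` F @^-1` U'), (F' \o F); split => //.
- by split => //=; rewrite FE.
- apply: (smooth_on_comp_real (O := U')) => //; first by move=> x [].
  by move=> k; apply: iter_diff_sub (sF k) => x [].
- by move=> q [Uq /=]; rewrite FE// => U'q; rewrite FE'.
Qed.

Lemma smooth_fun_coord B i j :
  @smooth_fun R (subset_space B) (fun p => val (p : B) i j).
Proof.
move=> p; exists setT, (fun M : 'M[R]_(m, n) => M i j).
split=> //; first exact: openT.
by move=> k; exact: iter_diff_coord.
Qed.

(** One direction tests the curve on coordinate functions; in the other, a smooth function along the
    curve is locally an ambient extension along it. Abstract curves are thereby reduced to ordinary
    calculus. *)
Lemma smooth_curve_subsetP B (c : R -> subset_space B) :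
  smooth_curve c <-> smooth_on [set: R] (fun t => val (c t : B)).
Proof.
split=> [sc|sc phi sphi k].
  apply/smooth_on_mxP => [|i j]; first exact: openT.
  exact: sc (smooth_fun_coord i j).
apply: iter_diff_local => t _; have [U [F [oU Up sF FE]]] := sphi (c t).
pose U' := (fun t => val (c t : B)) @^-1` U.
have oU' : open U'.
  rewrite openE => x Ux; apply: (smooth_on_continuous sc I).
  exact: open_nbhs_nbhs.
exists U' => //.
have : smooth_on U' (F \o (fun t => val (c t : B))).
  apply: (smooth_on_comp_real (O := U)) => //.
  by move=> l; apply: iter_diff_sub (sc l).
by move=> /(_ k); apply: iter_diff_eq => // x Ux /=; rewrite FE.
Qed.

(* The chain rule: a velocity depends only on the derivative of the curve in
   the ambient matrix space. *)
Lemma velocity_subset0 B (c : R -> subset_space B) : smooth_curve c ->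
  'D_1 (fun t => val (c t : B)) 0 = 0 -> velocity c = (fun=> 0).
Proof.
move=> sc D0; apply/funext => phi; rewrite /velocity; case: asboolP => // sphi.
have [U [F [oU Up sF FE]]] := sphi (c 0).
have /smooth_curve_subsetP sg := sc; set g := fun t => _ in sg D0.
have dg := smooth_on_differentiable sg (I : [set: R] 0).
have dF : differentiable F (g 0) by exact: (smooth_on_differentiable sF).
have E : {near (0 : R), F \o g =1 phi \o c}.
  have : \forall t \near (0 : R), U (g t).
    apply: (smooth_on_continuous sg I); exact: open_nbhs_nbhs.
  by apply: filterS => t Ut /=; rewrite FE.
rewrite derive1E -(near_eq_derive _ E) (derive_comp_mx _ dg dF) D0.
by apply: big1 => i _; apply: big1 => j _; rewrite mxE scale0r.
Qed.

End MatrixSubset.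

Section Frobenius.
Context {n : nat}.
Implicit Types A : set 'M[R]_n.

Lemma mx_coord_velocity A (c : R -> subset_space A) : smooth_curve c ->
  mx_coord (velocity c) = 'D_1 (fun t => mx (c t)) 0.
Proof.
move=> /[dup] sc /smooth_curve_subsetP sg; apply/matrixP => i j.
have dg := smooth_on_differentiable sg (I : [set: R] 0).
rewrite mxE /velocity asboolT; last exact: smooth_fun_coord.
by rewrite derive1E derive_coord.
Qed.

Lemma mx_coord_linear A (a : R) (u v : functional (subset_space A)) :
  mx_coord (fun phi => a * u phi + v phi) = a *: mx_coord u + mx_coord v.
Proof. by apply/matrixP => i j; rewrite !mxE. Qed.

Lemma frobenius_riemannian A : A `<=` sym -> riemannian_metric (@frobenius R n A).
Proof.
move=> As; split.
- move=> p a u v w _ _ _; rewrite /frobenius mx_coord_linear mulmxDl.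
  by rewrite -scalemxAl linearD linearZ.
- by move=> p u v _ _; rewrite /frobenius mxtrace_mulC.
- move=> p u [c [sc cp ->]] u0; rewrite /frobenius.
  (* A velocity whose matrix is zero is the zero functional by [velocity_subset0]. The matrix is
     symmetric because the entries (i, j) and (j, i) are the same function on [A]. *)
  have C0 : mx_coord (velocity c) != 0.
    apply: contra_notN u0 => /eqP; rewrite mx_coord_velocity//.
    exact: velocity_subset0.
  have sC : sym (mx_coord (velocity c)).
    rewrite /sym /=; apply/matrixP => i j; rewrite !mxE.
    congr (velocity c _); apply/funext => q.
    by have /matrixP/(_ i j) := As _ (set_mem (valP q)); rewrite mxE.
  apply: lt_le_trans (mxtrace_sqr_ge sC).
  by rewrite exprn_gt0// normr_gt0.
- move=> X Y [tX sX] [tY sY].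
  have := @smooth_fun_sum _ A _ (index_enum 'I_n) (fun i p => \sum_(j <- index_enum 'I_n)
     (X p (fun q => mx q i j) * Y p (fun q => mx q j i))).
  have H i : @smooth_fun R (subset_space A) (fun p => \sum_(j <- index_enum 'I_n)
     (X p (fun q => mx q i j) * Y p (fun q => mx q j i))).
    apply: smooth_fun_sum => j; apply: smooth_funM.
      exact/sX/smooth_fun_coord.
    exact/sY/smooth_fun_coord.
  move=> /(_ H); congr smooth_fun; apply/funext => p.
  rewrite /frobenius; apply: eq_bigr => i _; rewrite mxE.
  by apply: eq_bigr => j _; rewrite !mxE.
Qed.

End Frobenius.
End SubsetSpace.

(** * The off-log isometry *)

Section CorrelationMatrices.
Context {R : realType} {n : nat}.
Implicit Types (A B L D : 'M[R]_n).

Lemma diag_posP B : diag_pos B -> spd B /\ diag (logmx B).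
Proof.
move=> [/diag_mxP[d ->] d0].
have d0' i : 0 < d 0 i by have := d0 i; rewrite mxE eqxx mulr1n.
have E : diag_mx d = expmx (diag_mx (map_mx (@ln R) d)).
  rewrite expmx_diag; congr diag_mx; apply/rowP => i.
  by rewrite !mxE lnK// posrE.
have sD : sym (diag_mx (map_mx (@ln R) d)).
  by apply: diag_sym; exact: diag_mx_is_diag.
rewrite E expmxK//; split; first exact: expmx_spd.
exact: diag_mx_is_diag.
Qed.

Lemma expmx_diag_pos D : diag D -> diag_pos (expmx D).
Proof.
move=> /diag_mxP[d ->]; rewrite expmx_diag; split; first exact: diag_mx_is_diag.
by move=> i; rewrite !mxE eqxx mulr1n expR_gt0.
Qed.

Lemma diagD D D' : diag D -> diag D' -> diag (D + D').
Proof. by move=> dD dD'; apply: off_eq0_diag; rewrite linearD /= !off_diag// addr0. Qed.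

Lemma diagN D : diag D -> diag (- D).
Proof. by move=> dD; apply: off_eq0_diag; rewrite linearN /= off_diag// oppr0. Qed.

Lemma star_cosetE A : star_coset A = [set expmx (logmx A + D) | D in diag].
Proof.
apply/seteqP; split => [_ [B /diag_posP[_ dB] <-]|_ [D dD <-]].
  by exists (logmx B).
exists (expmx D); first exact: expmx_diag_pos.
by rewrite /star expmxK//; exact: diag_sym.
Qed.

Lemma star_coset_eq A B :
  star_coset A = star_coset B <-> off (logmx A) = off (logmx B).
Proof.
rewrite !star_cosetE; split=> [AB|AB].
  have : [set expmx (logmx B + D) | D in diag] (expmx (logmx A)).
    rewrite -AB; exists 0; last by rewrite addr0.
    by apply: off_eq0_diag; rewrite linear0.
  case=> D dD /expmx_sym_inj <-.
  - by rewrite linearD /= (off_diag dD) addr0.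
  - by apply: symD; [exact: sym_logmx|exact: diag_sym].
  - exact: sym_logmx.
have H A' B' : off (logmx A') = off (logmx B') ->
    [set expmx (logmx A' + D) | D in diag] `<=`
    [set expmx (logmx B' + D) | D in diag].
  move=> AB' _ [D dD <-]; exists (diag_part (logmx A') - diag_part (logmx B') + D).
    apply: diagD => //; apply: diagD; last apply: diagN; exact: diag_mx_is_diag.
  have oB : off (logmx B') = logmx B' - diag_part (logmx B').
    by rewrite -{2}(offDdiag_part (logmx B')) addrK.
  congr expmx; rewrite -{2}(offDdiag_part (logmx A')) AB' oB.
  by rewrite !addrA; congr (_ + D); rewrite addrAC.
by apply/seteqP; split; exact: H.
Qed.

Lemma off_hol A : hol A -> off A = A.
Proof.
move=> [_ A0]; apply/matrixP => i j; rewrite mxE.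
by case: eqP => // <-; rewrite A0.
Qed.

Lemma off_sym_hol A : sym A -> hol (off A).
Proof.
by move=> sA; have := set_mem (off_logmx_hol (expmx A)); rewrite expmxK.
Qed.

Lemma hol_sym A : hol A -> sym A. Proof. by case. Qed.

(** The diagonal of L plus D(L) is a diagonal correction for off L, and such a correction is unique.
    Hence exp (L + D(L)) depends on off L only. *)
Lemma cor_diag_off L : sym L -> off L + cor_diag (off L) = L + cor_diag L.
Proof.
move=> sL; have [dD cD] := cor_diagP sL.
have E : off L + (diag_part L + cor_diag L) = L + cor_diag L.
  by rewrite addrA offDdiag_part.
rewrite -E; congr (_ + _); apply: cor_diag_uniq.
- by have [] := off_sym_hol sL.
- by apply: diagD => //; exact: diag_mx_is_diag.
- by rewrite E.
Qed.

Lemma mxtrace_off_diag A B : off A = A -> off B = 0 -> \tr (A *m B) = 0.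
Proof.
move=> oA /off_eq0_diag/diag_mxP[d ->]; rewrite mul_mx_diag.
by apply: big1 => i _; rewrite mxE -oA mxE eqxx mul0r.
Qed.

End CorrelationMatrices.

(** * The diffeomorphisms Log and sigma_corr *)

Section OffLog.
Variables (R : realType) (n : nat).
Local Notation Spd := (Spd R n).
Local Notation Sym := (Sym R n).
Local Notation Cor := (Cor R n).
Local Notation Hol := (Hol R n).
Local Notation Quo := (Quo R n).
Implicit Types (S : Spd) (q : Quo).

Definition Sym_of (A : 'M[R]_n) (sA : sym A) : Sym := exist _ A (mem_set sA).

Definition Sym_exp (X : Sym) : Spd :=
  exist _ (expmx (mx X)) (mem_set (expmx_spd (set_mem (valP X)))).

Definition Hol_Cor (X : Hol) : Cor :=
  exist _ (expmx (mx X + cor_diag (mx X)))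
    (mem_set (proj2 (cor_diagP (hol_sym (set_mem (valP X)))))).

Definition Sym_off (X : Sym) : Hol :=
  exist _ (off (mx X)) (mem_set (off_sym_hol (set_mem (valP X)))).

Lemma mx_inj (A : set 'M[R]_n) : injective (@mx R n A).
Proof. exact: val_inj. Qed.

Lemma spd_mx S : spd (mx S). Proof. exact: set_mem (valP S). Qed.

Lemma sym_mx (X : Sym) : sym (mx X). Proof. exact: set_mem (valP X). Qed.

Lemma hol_mx (X : Hol) : hol (mx X). Proof. exact: set_mem (valP X). Qed.

Lemma cor_mx (C : Cor) : cor (mx C). Proof. exact: set_mem (valP C). Qed.

Lemma Sym_expK : cancel Sym_exp (@Spd_log R n).
Proof. by move=> X; apply: mx_inj; rewrite /mx /= expmxK//; exact: sym_mx. Qed.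

Lemma Spd_logK : cancel (@Spd_log R n) Sym_exp.
Proof. by move=> S; apply: mx_inj; rewrite /mx /= logmxK//; exact: spd_mx. Qed.

Lemma symp_spd_mx (A : 'M[R]_n) : spd A -> symp_spd A.
Proof. by move=> sA; rewrite /symp_spd /= symp_id//; case: sA. Qed.

Lemma Spd_log_smooth : smooth_map (@Spd_log R n).
Proof.
apply: subset_smooth_map => S; exists symp_spd, (fun M => logmx (symp M)).
split; [exact: open_symp_spd|exact/symp_spd_mx/spd_mx|
  exact: smooth_on_logmx_symp|].
by move=> T _ /=; rewrite symp_id//; case: (spd_mx T).
Qed.

Lemma Sym_exp_smooth : smooth_map Sym_exp.
Proof.
apply: subset_smooth_map => X; exists setT, (@expmx R n).
by split; [exact: openT| |exact: expmx_smooth|].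
Qed.

Lemma Spd_log_diffeo : diffeomorphism (@Spd_log R n).
Proof.
split; first exact: Spd_log_smooth.
by exists Sym_exp; split; [exact: Sym_exp_smooth|exact: Spd_logK|exact: Sym_expK].
Qed.

Lemma Sym_off_smooth : smooth_map Sym_off.
Proof.
apply: subset_smooth_map => X; exists setT, (@off R n).
split=> //; first exact: openT.
by apply: smooth_on_linear; exact: mx_linear_continuous.
Qed.

Lemma cor_to_spd_smooth : smooth_map (@cor_to_spd R n).
Proof.
apply: subset_smooth_map => C; exists setT, (@idfun 'M[R]_n).
split=> //; first exact: openT.
by apply: smooth_on_linear; exact: mx_linear_continuous.
Qed.

Lemma Cor_LogE : @Cor_Log R n = Sym_off \o @Spd_log R n \o @cor_to_spd R n.
Proof. by apply/funext => C; exact: mx_inj. Qed.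

Lemma Cor_Log_smooth : smooth_map (@Cor_Log R n).
Proof.
rewrite Cor_LogE; apply: smooth_map_comp; first exact: cor_to_spd_smooth.
by apply: smooth_map_comp; [exact: Spd_log_smooth|exact: Sym_off_smooth].
Qed.

Lemma Hol_Cor_smooth : smooth_map Hol_Cor.
Proof.
apply: subset_smooth_map => X.
exists setT, (fun M : 'M[R]_n => expmx (M + cor_diag (symp M))).
split; [exact: openT|by []| |].
  apply: (smooth_on_comp (O := setT) (f := fun M : 'M[R]_n => M + cor_diag (symp M)));
    [exact: openT|exact: openT|by []|exact: expmx_smooth|].
  apply: (smooth_onD (f := idfun)); [exact: openT| |exact: smooth_on_cor_diag_symp].
  by apply: smooth_on_linear; exact: mx_linear_continuous.
by move=> Y _ /=; rewrite symp_id//; exact/hol_sym/hol_mx.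
Qed.

Lemma Hol_CorK : cancel Hol_Cor (@Cor_Log R n).
Proof.
move=> X; have [dD _] := cor_diagP (hol_sym (hol_mx X)).
apply: mx_inj; rewrite /mx /= expmxK.
  by rewrite linearD /= (off_diag dD) addr0 off_hol//; exact: hol_mx.
by apply: symD; [exact/hol_sym/hol_mx|exact: diag_sym].
Qed.

Lemma Cor_LogK : cancel (@Cor_Log R n) Hol_Cor.
Proof.
move=> C; apply: mx_inj; have [sC C1] := cor_mx C; rewrite /mx /=.
(* log C already exponentiates to a matrix with unit diagonal, so its correction D(log C) is 0. *)
rewrite (cor_diag_off (sym_logmx _)) (_ : cor_diag _ = 0) ?addr0 ?logmxK//.
apply: cor_diag_uniq; [exact: sym_logmx| |by rewrite addr0 logmxK].
by apply: off_eq0_diag; rewrite linear0.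
Qed.

Lemma Cor_Log_diffeo : diffeomorphism (@Cor_Log R n).
Proof.
split; first exact: Cor_Log_smooth.
by exists Hol_Cor; split; [exact: Hol_Cor_smooth|exact: Cor_LogK|exact: Hol_CorK].
Qed.

Definition off_log : Spd -> Hol := Sym_off \o @Spd_log R n.

Lemma mx_off_log S : mx (off_log S) = off (mx (@Spd_log R n S)).
Proof. by []. Qed.

Lemma off_log_smooth : smooth_map off_log.
Proof. by apply: smooth_map_comp; [exact: Spd_log_smooth|exact: Sym_off_smooth]. Qed.

Lemma quo_pi_eq S T : @quo_pi R n S = @quo_pi R n T <-> off_log S = off_log T.
Proof.
split=> [/(congr1 val)/star_coset_eq|/(congr1 (@mx R n hol)) H].
  by move=> H; exact: mx_inj.
by apply: val_inj; apply/star_coset_eq.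
Qed.

Lemma quo_pi_surj q : exists S, @quo_pi R n S = q.
Proof.
have [A sA Aq] := set_mem (valP q).
by exists (exist _ A (mem_set sA)); exact: val_inj.
Qed.

Definition quo_rep q : Spd := sval (cid (quo_pi_surj q)).

Lemma quo_repK q : @quo_pi R n (quo_rep q) = q.
Proof. exact: svalP (cid (quo_pi_surj q)). Qed.

(** Built from off log and an arbitrary representative, whose choice has no effect by
    [sigma_corr_pi]; [sigma_corrE] and [star_cor_factor] recover the formula with D_Sigma. *)
Definition sigma_corr : Quo -> Cor := Hol_Cor \o off_log \o quo_rep.

Lemma sigma_corr_pi S : sigma_corr (@quo_pi R n S) = Hol_Cor (off_log S).
Proof.
by rewrite /sigma_corr /=; congr Hol_Cor; apply/quo_pi_eq; rewrite quo_repK.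
Qed.

Lemma quo_pi_smooth : smooth_map (@quo_pi R n).
Proof. by []. Qed.

(** Smoothness on the quotient is tested after composing with [quo_pi], where the choice of
    representatives, possibly not smooth, has disappeared. *)
Lemma sigma_corr_smooth : smooth_map sigma_corr.
Proof.
move=> phi /Hol_Cor_smooth/off_log_smooth H.
rewrite /smooth_fun /=; move: H; congr smooth_fun.
by apply/funext => S /=; rewrite -sigma_corr_pi.
Qed.

Lemma sigma_corr_section q : @quo_pi R n (@cor_to_spd R n (sigma_corr q)) = q.
Proof.
rewrite -[in RHS](quo_repK q); apply/quo_pi_eq.
have <- : @Cor_Log R n (sigma_corr q) = off_log (cor_to_spd (sigma_corr q)).
  by rewrite Cor_LogE.
by rewrite /sigma_corr /= Hol_CorK.
Qed.

Lemma sigma_corr_diffeo : diffeomorphism sigma_corr.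
Proof.
split; first exact: sigma_corr_smooth.
exists (@quo_pi R n \o @cor_to_spd R n); split.
- exact: smooth_map_comp cor_to_spd_smooth quo_pi_smooth.
- exact: sigma_corr_section.
- by move=> C /=; rewrite sigma_corr_pi -[RHS]Cor_LogK Cor_LogE.
Qed.

Lemma sigma_corrE S :
  mx (sigma_corr (@quo_pi R n S)) =
  expmx (cor_diag (logmx (mx S)) + logmx (mx S)).
Proof.
rewrite sigma_corr_pi /mx /= (cor_diag_off (sym_logmx _)).
by rewrite addrC.
Qed.

Lemma star_cor_factor S : star (mx S) (cor_factor (mx S)) =
  expmx (cor_diag (logmx (mx S)) + logmx (mx S)).
Proof.
have [dD _] := cor_diagP (sym_logmx (mx S)).
by rewrite /star /cor_factor expmxK 1?addrC//; exact: diag_sym.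
Qed.


(** * The quotient metric, horizontal lifts and uniqueness *)

Definition gQ : metric Quo := pullback sigma_corr (@gOL R n).

Lemma gLE_riemannian : riemannian_metric (@gLE R n).
Proof.
apply: pullback_riemannian; first exact: Spd_log_diffeo.
exact: frobenius_riemannian.
Qed.

Lemma gOL_riemannian : riemannian_metric (@gOL R n).
Proof.
apply: pullback_riemannian; first exact: Cor_Log_diffeo.
by apply: frobenius_riemannian => A; exact: hol_sym.
Qed.

Lemma gQ_riemannian : riemannian_metric gQ.
Proof.
by apply: pullback_riemannian; [exact: sigma_corr_diffeo|exact: gOL_riemannian].
Qed.

(** A global chart of the quotient in Hol(n): in it [gQ] is the Frobenius metric and [quo_pi]
    becomes off log. *)
Definition quo_log : Quo -> Hol := @Cor_Log R n \o sigma_corr.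

Lemma quo_log_pi : quo_log \o @quo_pi R n = off_log.
Proof.
by apply/funext => S /=; rewrite /quo_log /= sigma_corr_pi Hol_CorK.
Qed.

Lemma quo_log_diffeo : diffeomorphism quo_log.
Proof. exact: diffeomorphism_comp sigma_corr_diffeo Cor_Log_diffeo. Qed.

Lemma quo_log_smooth : smooth_map quo_log. Proof. by case: quo_log_diffeo. Qed.

Lemma quo_log_inj : injective quo_log.
Proof. by case: quo_log_diffeo => _ [h [_ hK _]]; exact: can_inj hK. Qed.

Lemma gQE q u v : gQ q u v =
  \tr (mx_coord (push quo_log u) *m mx_coord (push quo_log v)).
Proof.
by rewrite /gQ /gOL /pullback /frobenius !push_comp//; exact: Cor_Log_smooth.
Qed.

Lemma gLEE S u v : gLE S u v =
  \tr (mx_coord (push (@Spd_log R n) u) *m mx_coord (push (@Spd_log R n) v)).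
Proof. by []. Qed.

Lemma mx_coord_quo_log S u : tangent S u ->
  mx_coord (push quo_log (push (@quo_pi R n) u)) =
  off (mx_coord (push (@Spd_log R n) u)).
Proof.
move=> [c [sc _ ->]].
rewrite push_comp; last exact: quo_log_smooth.
rewrite quo_log_pi !push_velocity; [|exact: Spd_log_smooth|exact: off_log_smooth].
have sl := smooth_curve_comp Spd_log_smooth sc.
rewrite !mx_coord_velocity//; last exact: smooth_curve_comp off_log_smooth sc.
have /smooth_curve_subsetP sg := sl.
have dg := smooth_on_differentiable sg (I : [set: R] 0).
have -> : (fun t => mx ((off_log \o c) t)) =
    @off R n \o (fun t => mx ((@Spd_log R n \o c) t)) by [].
have cO : continuous (@off R n) by exact: mx_linear_continuous.
have dO x : differentiable (@off R n) x by exact: linear_differentiable.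
rewrite deriveE; last exact: differentiable_comp.
by rewrite diff_comp//= diff_lin// -deriveE.
Qed.

Lemma velocity_Sym_exp (L : R -> Sym) : smooth_curve L ->
  mx_coord (push (@Spd_log R n) (velocity (Sym_exp \o L))) =
  'D_1 (fun t => mx (L t)) 0.
Proof.
move=> sL; rewrite push_velocity; last exact: Spd_log_smooth.
have -> : @Spd_log R n \o (Sym_exp \o L) = L.
  by apply/funext => t /=; rewrite Sym_expK.
exact: mx_coord_velocity.
Qed.

Lemma vertical_off S v : vertical (@quo_pi R n) S v ->
  off (mx_coord (push (@Spd_log R n) v)) = 0.
Proof.
move=> [tv v0]; rewrite -(mx_coord_quo_log tv) v0 push0.
by apply/matrixP => i j; rewrite !mxE.
Qed.

(** The curve t -> exp (log S + t E_ii) never leaves the coset of S, so its velocity is pushed to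
    that of a constant curve. Testing horizontality on these vectors isolates one diagonal entry at
    a time. *)
Lemma vertical_delta S i : exists2 v, vertical (@quo_pi R n) S v &
  mx_coord (push (@Spd_log R n) v) = diag_mx (delta_mx 0 i).
Proof.
pose E : 'M[R]_n := diag_mx (delta_mx 0 i).
have dE : diag E by exact: diag_mx_is_diag.
have sE : sym E by exact: diag_sym.
have sL t : sym (logmx (mx S) + t *: E).
  by apply: symD; [exact: sym_logmx|exact: symZ].
pose L t := Sym_of (sL t).
have scale_smooth : smooth_on [set: R] (scale_mx E : R -> _).
  move=> k; exact: (iter_diff_linear k setT (@scale_mx_continuous R n n E)).
have smL : smooth_curve L.
  apply/smooth_curve_subsetP.
  have := smooth_onD openT (@smooth_on_cst R R _ setT (logmx (mx S))) scale_smooth.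
  exact: smooth_on_eq openT _.
exists (velocity (Sym_exp \o L)).
  have smE : smooth_curve (Sym_exp \o L) := smooth_curve_comp Sym_exp_smooth smL.
  split.
    exists (Sym_exp \o L); split => //; apply: mx_inj.
    transitivity (expmx (logmx (mx S) + 0 *: E)); first by [].
    by rewrite scale0r addr0 logmxK//; exact: spd_mx.
  rewrite push_velocity//; apply/funext => phi; rewrite /velocity.
  case: asboolP => // _.
  have -> : phi \o (@quo_pi R n \o (Sym_exp \o L)) = cst (phi (quo_pi S)).
    apply/funext => t /=; congr phi; apply/quo_pi_eq.
    apply: mx_inj; transitivity (off (logmx (expmx (logmx (mx S) + t *: E)))); first by [].
    by rewrite expmxK// linearD linearZ /= (off_diag dE) scaler0 addr0.
  exact: derive1_cst.
rewrite velocity_Sym_exp//.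
have -> : (fun t => mx (L t)) = cst (logmx (mx S)) \+ scale_mx E by [].
have cs := @scale_mx_continuous R n n E.
have ds : differentiable (scale_mx E : R -> _) 0 by exact: linear_differentiable.
rewrite deriveD; [|exact: derivable_cst|exact: diff_derivable].
by rewrite derive_cst add0r deriveE// diff_lin//; exact: scale1r.
Qed.

Lemma horizontal_off S u : horizontal (@gLE R n) (@quo_pi R n) S u ->
  off (mx_coord (push (@Spd_log R n) u)) = mx_coord (push (@Spd_log R n) u).
Proof.
move=> [tu hu]; set C := mx_coord _.
apply/matrixP => i j; rewrite mxE; case: eqP => // <-.
have [v vv Ev] := vertical_delta S i.
by have := hu v vv; rewrite gLEE Ev mxtrace_mul_delta => ->.
Qed.

Lemma horizontal_lift S w : tangent (@quo_pi R n S) w ->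
  exists2 u, horizontal (@gLE R n) (@quo_pi R n) S u & w = push (@quo_pi R n) u.
Proof.
move=> [c [sc c0 ->]].
pose h t : 'M[R]_n := mx (quo_log (c t)).
have sh : smooth_on [set: R] h.
  by apply/smooth_curve_subsetP; exact: smooth_curve_comp quo_log_smooth sc.
have hh t : hol (h t) by exact: hol_mx.
have h0 : h 0 = off (logmx (mx S)).
  by rewrite /h c0 -[quo_log _]/((quo_log \o @quo_pi R n) S) quo_log_pi.
pose d := diag_part (logmx (mx S)).
have dd : diag d by exact: diag_mx_is_diag.
have sL t : sym (d + h t) by apply: symD; [exact: diag_sym|exact: hol_sym].
pose L t := Sym_of (sL t).
have smL : smooth_curve L.
  apply/smooth_curve_subsetP.
  have := smooth_onD openT (@smooth_on_cst R R _ setT d) sh.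
  exact: smooth_on_eq openT _.
have smE : smooth_curve (Sym_exp \o L) := smooth_curve_comp Sym_exp_smooth smL.
have lift : @quo_pi R n \o (Sym_exp \o L) = c.
  apply/funext => t /=; apply: quo_log_inj.
  rewrite -[LHS]/((quo_log \o @quo_pi R n) (Sym_exp (L t))) quo_log_pi.
  apply: mx_inj; rewrite mx_off_log Sym_expK.
  rewrite -/(h t) -[mx (L t)]/(d + h t).
  by rewrite linearD /= (off_diag dd) add0r off_hol.
exists (velocity (Sym_exp \o L)); last by rewrite push_velocity// lift.
have tL : tangent S (velocity (Sym_exp \o L)).
  exists (Sym_exp \o L); split => //; apply: mx_inj.
  transitivity (expmx (d + h 0)); first by [].
  by rewrite h0 addrC offDdiag_part logmxK//; exact: spd_mx.
split=> // v /vertical_off ov; rewrite gLEE.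
apply: mxtrace_off_diag => //; rewrite velocity_Sym_exp//.
have /smooth_curve_subsetP sg := smL.
have dg := smooth_on_differentiable sg (I : [set: R] 0).
apply/matrixP => i j; rewrite mxE; case: eqP => // <-.
rewrite derive_coord// (_ : (fun t => _) = cst (d i i)) ?derive_cst//.
apply/funext => t; rewrite /mx /= mxE.
by have [_ ->] := hh t; rewrite addr0.
Qed.

Lemma quo_pi_riemannian_submersion :
  riemannian_submersion (@gLE R n) gQ (@quo_pi R n).
Proof.
split; [exact: gLE_riemannian|exact: gQ_riemannian| |].
  split; first exact: quo_pi_smooth.
  by move=> S w /horizontal_lift[u [tu _] ->]; exists u.
move=> S u v hu hv; have [tu _] := hu; have [tv _] := hv.
by rewrite gQE gLEE (mx_coord_quo_log tu) (mx_coord_quo_log tv) (horizontal_off hu) (horizontal_off hv).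
Qed.

(** The submersion condition fixes the metric on images of horizontal vectors, and by
    [horizontal_lift] these are all the tangent vectors. *)
Lemma riemannian_submersion_uniq (g' : metric Quo) :
  riemannian_submersion (@gLE R n) g' (@quo_pi R n) -> metric_eq g' gQ.
Proof.
move=> [_ _ _ g'E] q u v; have [_ _ _ gQE'] := quo_pi_riemannian_submersion.
have [S <-] := quo_pi_surj q.
move=> /horizontal_lift[a ha ->] /horizontal_lift[b hb ->].
by rewrite g'E// gQE'.
Qed.

End OffLog.

Theorem corollary4p24 (R : realType) (n : nat) :
  exists (gQ : metric (Quo R n)) (sigma : Quo R n -> Cor R n),
    [/\ riemannian_submersion (@gLE R n) gQ (@quo_pi R n),
        (forall g' : metric (Quo R n),
          riemannian_submersion (@gLE R n) g' (@quo_pi R n) -> metric_eq g' gQ),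
        (forall S : Spd R n,
          mx (sigma (quo_pi S)) = star (mx S) (cor_factor (mx S)) /\
          mx (sigma (quo_pi S)) =
            expmx (cor_diag (logmx (mx S)) + logmx (mx S))),
        (forall q : Quo R n, quo_pi (cor_to_spd (sigma q)) = q)
      & riemannian_isometry gQ (@gOL R n) sigma].
Proof.
exists (@gQ R n), (@sigma_corr R n); split.
- exact: quo_pi_riemannian_submersion.
- exact: riemannian_submersion_uniq.
- by move=> S; rewrite star_cor_factor sigma_corrE.
- exact: sigma_corr_section.
- split=> //; [exact: gQ_riemannian|exact: gOL_riemannian|].
  exact: sigma_corr_diffeo.
Qed.
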